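(* Let $\mathcal K$ be a 2-category, $n$ a positive integer and $1\le k\le n$. The following assignments define a 2-functor $C_k:\mathsf{Wdl}^{(n)}(\overline{\mathcal K})\to\mathsf{Wdl}^{(n-1)}(\overline{\mathcal K})$. A 0-cell $\{\lambda_{i,j}:s_js_i\to s_is_j\}_{0\le i<j\le n}$ is sent to the 0-cell whose $n$ monads are, in this order, $s_0,\dots,s_{k-2}$, the monad $(s_{k-1}s_k,\bar\lambda_{k-1,k})$ in $\overline{\mathcal K}$ induced by $\lambda_{k-1,k}$, and $s_{k+1},\dots,s_n$, with weak distributive laws: $\lambda_{i,j}:s_js_i\to s_is_j$ if $i,j\notin\{k-1,k\}$; $s_{k-1}\lambda_{k,j}.\lambda_{k-1,j}s_k.s_j\bar\lambda_{k-1,k}:s_j(s_{k-1}s_k)\to(s_{k-1}s_k)s_j$ if $k<j$; and $\lambda_{i,k-1}s_k.s_{k-1}\lambda_{i,k}.\bar\lambda_{k-1,k}s_i:(s_{k-1}s_k)s_i\to s_i(s_{k-1}s_k)$ if $i<k-1$. A 1-cell $(v,\{\xi_i:s'_iv\to vs_i\}_{0\le i\le n})$ is sent to the 1-cell with the same $v$ and the 2-cells $\xi_i$ for $0\le i<k-1$, then $v\bar\lambda_{k-1,k}.\xi_{k-1}s_k.s'_{k-1}\xi_k:(s'_{k-1}s'_k)v\to v(s_{k-1}s_k)$, then $\xi_{i+1}:s'_{i+1}v\to vs_{i+1}$ for $k-1<i<n$. A 2-cell is sent to itself. (In particular, these are a 0-cell, 1-cell and 2-cell of $\mathsf{Wdl}^{(n-1)}(\overline{\mathcal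 K})$ respectively.)
   Context: Conventions. For 1-cells, $uw$ is the horizontal composite ($w$ applied first); for 2-cells $\alpha,\beta$, $\alpha\beta$ is their horizontal composite; a 1-cell written next to a 2-cell means whiskering by its identity 2-cell; $\alpha.\beta$ is vertical composition ($\beta$ first). A monad $(A,t)$ has multiplication $\mu:tt\to t$ and unit $\eta:1_A\to t$; decorations of $t$ (indices, primes) carry over to $\mu,\eta$. Local idempotent closure $\overline{\mathcal K}$: same 0-cells as $\mathcal K$; 1-cells $A\to B$ are pairs $(v,\bar v)$ with $v:A\to B$ a 1-cell of $\mathcal K$ and $\bar v:v\to v$ an idempotent 2-cell; 2-cells $(v,\bar v)\to(v',\bar v')$ are 2-cells $\omega:v\to v'$ of $\mathcal K$ with $\bar v'.\omega=\omega=\omega.\bar v$; compositions are induced from $\mathcal K$ (horizontal composite of $(u,\bar u),(w,\bar w)$ is $(uw,\bar u\bar w)$), the identity 2-cell of $(v,\bar v)$ is $\bar v$. A monad $(A,(t,\bar t))$ in $\overline{\mathcal K}$ is given by 2-cells $\mu,\eta$ of $\mathcal K$ satisfying the monad axioms in $\overline{\mathcal K}$ (so $\mu.t\eta=\mu.\eta t=\bar t$); we often write just $t$, and write $v$ for $(v,\bar v)$. For $\mathcal L\in\{\mathcal K,\overline{\mathcal K}\}$, $\mathsf{Mnd}(\mathcal L)$ has as 0-cells the monads $(A,t)$ in $\mathcal L$; 1-cells $(A,t)\to(A',t')$ are pairs $(v,\psi)$ with $v:A\to A'$ and $\psi:t'v\to vt$ in $\mathcal L$, $\psi.\mu'v=v\mu.\psi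 t.t'\psi$, $\psi.\eta'v=v\eta$; 2-cells $(v,\psi)\to(v',\psi')$ are $\omega:v\to v'$ with $\psi'.t'\omega=\omega t.\psi$. A weak distributive law in $\mathcal L$: monads $(A,t),(A,s)$ in $\mathcal L$ and a 2-cell $\lambda:ts\to st$ of $\mathcal L$ with $\lambda.\mu s=s\mu.\lambda t.t\lambda$, $\lambda.t\mu=\mu t.s\lambda.\lambda s$, $\lambda.\eta s=\mu t.s\lambda.st\eta.s\eta$, $\lambda.t\eta=s\mu.\lambda t.\eta st.\eta t$. Its idempotent is $\bar\lambda:=\mu t.s\lambda.st\eta=s\mu.\lambda t.\eta st$. For $\lambda$ in $\overline{\mathcal K}$, the induced monad (weak wreath product) is $(A,(st,\bar\lambda))$ in $\overline{\mathcal K}$ with multiplication $\mu\mu.s\lambda t$ and unit $\lambda.\eta\eta$. $\mathsf{Wdl}(\mathcal L)$: 0-cells are weak distributive laws in $\mathcal L$; a 1-cell from $\lambda:ts\to st$ (on $A$) to $\lambda':t's'\to s't'$ (on $A'$) is $(v,\xi,\zeta)$ with $(v,\xi):(A,t)\to(A',t')$, $(v,\zeta):(A,s)\to(A',s')$ 1-cells of $\mathsf{Mnd}(\mathcal L)$ and $v\lambda.\xi s.t'\zeta=v\bar\lambda.\zeta t.s'\xi.\lambda'v$; 2-cells are 2-cells $\omega$ of $\mathcal L$ that are 2-cells of $\mathsf{Mnd}(\mathcal L)$ both $(v,\xi)\to(v',\xi')$ and $(v,\zeta)\to(v',\zeta')$. $\mathsf{Wdl}^{(n)}(\mathcal L)$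 ($n\ge0$): a 0-cell consists of monads $(A,s_0),\dots,(A,s_n)$ in $\mathcal L$ on one object and weak distributive laws $\lambda_{i,j}:s_js_i\to s_is_j$ ($0\le i<j\le n$) satisfying the Yang–Baxter relation $\lambda_{i,j}s_k.s_j\lambda_{i,k}.\lambda_{j,k}s_i=s_i\lambda_{j,k}.\lambda_{i,k}s_j.s_k\lambda_{i,j}$ for $i<j<k$. A 1-cell to $\{\lambda'_{i,j}:s'_js'_i\to s'_is'_j\}$ (on $A'$) is $v:A\to A'$ with 2-cells $\xi_i:s'_iv\to vs_i$ such that each $(v,\xi_i)$ is a 1-cell of $\mathsf{Mnd}(\mathcal L)$ and each $(v,\xi_i,\xi_j)$, $i<j$, is a 1-cell $\lambda_{i,j}\to\lambda'_{i,j}$ of $\mathsf{Wdl}(\mathcal L)$; 2-cells are $\omega:v\to v'$ which are 2-cells $(v,\xi_i)\to(v',\xi'_i)$ of $\mathsf{Mnd}(\mathcal L)$ for all $i$; compositions come from $\mathcal L$. So $\mathsf{Wdl}^{(0)}(\mathcal L)=\mathsf{Mnd}(\mathcal L)$, $\mathsf{Wdl}^{(1)}(\mathcal L)=\mathsf{Wdl}(\mathcal L)$. $\bar\lambda_{ij}$ denotes the idempotent of $\lambda_{i,j}$. *)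

(* Defs.v *)
(* strict 2-categories, encoded with
   object-indexed hom-types of 1-cells and of 2-cells, where every 2-cell
   carries its source and target 1-cell (src/tgt); compositions are total
   functions, and the axioms are only required on composable inputs.
   This avoids transports along equalities of 1-cells. *)
From Stdlib Require Import Arith.

Record PreTwoCat := {
  kob : Type;
  khom : kob -> kob -> Type;
  kcell : kob -> kob -> Type;
  ksrc : forall A B, kcell A B -> khom A B;
  ktgt : forall A B, kcell A B -> khom A B;
  kid1 : forall A, khom A A;
  kcomp1 : forall A B C, khom B C -> khom A B -> khom A C;
  kid2 : forall A B, khom A B -> kcell A B;
  kvcomp : forall A B, kcell A B -> kcell A B -> kcell A B; (* a . b : b first *)
  khcomp : forall A B C, kcell B C -> kcell A B -> kcell A C }.

Arguments ksrc {K A B} _ : rename.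
Arguments ktgt {K A B} _ : rename.
Arguments kid1 {K} A : rename.
Arguments kcomp1 {K A B C} _ _ : rename.
Arguments kid2 {K A B} _ : rename.
Arguments kvcomp {K A B} _ _ : rename.
Arguments khcomp {K A B C} _ _ : rename.

Definition is_two_category (K : PreTwoCat) : Prop :=
  (forall A B (f : khom K A B), ksrc (kid2 f) = f /\ ktgt (kid2 f) = f) /\
  (forall A B (a b : kcell K A B), ktgt b = ksrc a ->
      ksrc (kvcomp a b) = ksrc b /\ ktgt (kvcomp a b) = ktgt a) /\
  (forall A B C (a : kcell K B C) (b : kcell K A B),
      ksrc (khcomp a b) = kcomp1 (ksrc a) (ksrc b) /\
      ktgt (khcomp a b) = kcomp1 (ktgt a) (ktgt b)) /\
  (forall A B C D (f : khom K C D) (g : khom K B C) (h : khom K A B),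
      kcomp1 (kcomp1 f g) h = kcomp1 f (kcomp1 g h)) /\
  (forall A B (f : khom K A B), kcomp1 (kid1 B) f = f /\ kcomp1 f (kid1 A) = f) /\
  (forall A B (a b c : kcell K A B), ktgt c = ksrc b -> ktgt b = ksrc a ->
      kvcomp (kvcomp a b) c = kvcomp a (kvcomp b c)) /\
  (forall A B (a : kcell K A B),
      kvcomp (kid2 (ktgt a)) a = a /\ kvcomp a (kid2 (ksrc a)) = a) /\
  (forall A B C D (a : kcell K C D) (b : kcell K B C) (c : kcell K A B),
      khcomp (khcomp a b) c = khcomp a (khcomp b c)) /\
  (forall A B (a : kcell K A B),
      khcomp (kid2 (kid1 B)) a = a /\ khcomp a (kid2 (kid1 A)) = a) /\
  (forall A B C (f : khom K B C) (g : khom K A B),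
      khcomp (kid2 f) (kid2 g) = kid2 (kcomp1 f g)) /\
  (forall A B C (a b : kcell K B C) (c d : kcell K A B),
      ktgt b = ksrc a -> ktgt d = ksrc c ->
      khcomp (kvcomp a b) (kvcomp c d) = kvcomp (khcomp a c) (khcomp b d)).

(* Generic 2-category data with validity predicates for 1- and 2-cells;
   used as the common interface for K and for its local idempotent closure. *)
Record Cat2 := {
  ob : Type;
  hom : ob -> ob -> Type;
  cell : ob -> ob -> Type;
  ok1 : forall A B, hom A B -> Prop;
  ok2 : forall A B, cell A B -> Prop;
  src : forall A B, cell A B -> hom A B;
  tgt : forall A B, cell A B -> hom A B;
  id1 : forall A, hom A A;
  comp1 : forall A B C, hom B C -> hom A B -> hom A C;
  id2 : forall A B, hom A B -> cell A B;
  vcomp : forall A B, cell A B -> cell A B -> cell A B;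
  hcomp : forall A B C, cell B C -> cell A B -> cell A C }.

Arguments ok1 {C A B} _ : rename.
Arguments ok2 {C A B} _ : rename.
Arguments src {C A B} _ : rename.
Arguments tgt {C A B} _ : rename.
Arguments id1 {C} A : rename.
Arguments comp1 {C A B D} _ _ : rename.
Arguments id2 {C A B} _ : rename.
Arguments vcomp {C A B} _ _ : rename.
Arguments hcomp {C A B D} _ _ : rename.

Section Bar.
Variable K : PreTwoCat.

Definition bhom (A B : kob K) : Type := (khom K A B * kcell K A B)%type.
Definition bcell (A B : kob K) : Type := (bhom A B * bhom A B * kcell K A B)%type.

Definition bok1 {A B} (f : bhom A B) : Prop :=
  ksrc (snd f) = fst f /\ ktgt (snd f) = fst f /\ kvcomp (snd f) (snd f) = snd f.

Definition bok2 {A B} (a : bcell A B) : Prop :=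
  let '(f, g, w) := a in
  bok1 f /\ bok1 g /\ ksrc w = fst f /\ ktgt w = fst g /\
  kvcomp (snd g) w = w /\ kvcomp w (snd f) = w.

Definition bar : Cat2 := {|
  ob := kob K;
  hom := bhom;
  cell := bcell;
  ok1 := @bok1;
  ok2 := @bok2;
  src A B a := fst (fst a);
  tgt A B a := snd (fst a);
  id1 A := (kid1 A, kid2 (kid1 A));
  comp1 A B C u w := (kcomp1 (fst u) (fst w), khcomp (snd u) (snd w));
  id2 A B v := (v, v, snd v);
  vcomp A B a b := (fst (fst b), snd (fst a), kvcomp (snd a) (snd b));
  hcomp A B C a b :=
    let '(fa, ga, wa) := a in let '(fb, gb, wb) := b in
    ((kcomp1 (fst fa) (fst fb), khcomp (snd fa) (snd fb)),
     (kcomp1 (fst ga) (fst gb), khcomp (snd ga) (snd gb)),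
     khcomp wa wb) |}.

Definition retype {A B} (a : cell bar A B) (f g : hom bar A B) : cell bar A B :=
  (f, g, snd a).
End Bar.
Arguments retype {K A B} _ _ _.

Section Generic.
Variable L : Cat2.

Definition typ {A B} (a : cell L A B) (f g : hom L A B) : Prop :=
  ok2 a /\ src a = f /\ tgt a = g.

Definition wl {A B D} (f : hom L B D) (a : cell L A B) : cell L A D := hcomp (id2 f) a.
Definition wr {A B D} (a : cell L B D) (f : hom L A B) : cell L A D := hcomp a (id2 f).

Record mon (A : ob L) := Mon { mt : hom L A A; mmu : cell L A A; meta : cell L A A }.
Arguments mt {A} _.
Arguments mmu {A} _.
Arguments meta {A} _.
Arguments Mon {A} _ _ _.

Definition is_monad {A} (m : mon A) : Prop :=
  let t := mt m in let mu := mmu m in let eta := meta m in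
  ok1 t /\ typ mu (comp1 t t) t /\ typ eta (id1 A) t /\
  vcomp mu (wr mu t) = vcomp mu (wl t mu) /\
  vcomp mu (wl t eta) = id2 t /\
  vcomp mu (wr eta t) = id2 t.

Definition mnd1 {A A'} (m : mon A) (m' : mon A') (v : hom L A A') (psi : cell L A A') : Prop :=
  ok1 v /\ typ psi (comp1 (mt m') v) (comp1 v (mt m)) /\
  vcomp psi (wr (mmu m') v) = vcomp (wl v (mmu m)) (vcomp (wr psi (mt m)) (wl (mt m') psi)) /\
  vcomp psi (wr (meta m') v) = wl v (meta m).

Definition mnd2 {A A'} (m : mon A) (m' : mon A') (v v' : hom L A A') (psi psi' : cell L A A')
  (omega : cell L A A') : Prop :=
  typ omega v v' /\ vcomp psi' (wl (mt m') omega) = vcomp (wr omega (mt m)) psi.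

Definition is_wdl {A} (t s : mon A) (lam : cell L A A) : Prop :=
  is_monad t /\ is_monad s /\
  typ lam (comp1 (mt t) (mt s)) (comp1 (mt s) (mt t)) /\
  vcomp lam (wr (mmu t) (mt s)) =
    vcomp (wl (mt s) (mmu t)) (vcomp (wr lam (mt t)) (wl (mt t) lam)) /\
  vcomp lam (wl (mt t) (mmu s)) =
    vcomp (wr (mmu s) (mt t)) (vcomp (wl (mt s) lam) (wr lam (mt s))) /\
  vcomp lam (wr (meta t) (mt s)) =
    vcomp (wr (mmu s) (mt t)) (vcomp (wl (mt s) lam)
      (vcomp (wl (comp1 (mt s) (mt t)) (meta s)) (wl (mt s) (meta t)))) /\
  vcomp lam (wl (mt t) (meta s)) =
    vcomp (wl (mt s) (mmu t)) (vcomp (wr lam (mt t))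
      (vcomp (wr (meta t) (comp1 (mt s) (mt t))) (wr (meta s) (mt t)))).

Definition lambar {A} (t s : mon A) (lam : cell L A A) : cell L A A :=
  vcomp (wr (mmu s) (mt t)) (vcomp (wl (mt s) lam) (wl (comp1 (mt s) (mt t)) (meta s))).

Definition wdl1 {A A'} (t s : mon A) (lam : cell L A A) (t' s' : mon A') (lam' : cell L A' A')
  (v : hom L A A') (xi zeta : cell L A A') : Prop :=
  mnd1 t t' v xi /\ mnd1 s s' v zeta /\
  vcomp (wl v lam) (vcomp (wr xi (mt s)) (wl (mt t') zeta)) =
  vcomp (wl v (lambar t s lam)) (vcomp (wr zeta (mt t)) (vcomp (wl (mt s') xi) (wr lam' v))).

(* Wdl^(n)(L): data of 0-cells (monads s_0..s_n, laws lam_{i,j}), indexed by nat;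
   only indices <= n matter. *)
Record wdln0 := W0 { wob : ob L; ws : nat -> mon wob; wlam : nat -> nat -> cell L wob wob }.

Definition is_wdln0 (n : nat) (X : wdln0) : Prop :=
  (forall i, i <= n -> is_monad (ws X i)) /\
  (forall i j, i < j <= n -> is_wdl (ws X j) (ws X i) (wlam X i j)) /\
  (forall i j k, i < j < k /\ k <= n ->
     let si := mt (ws X i) in let sj := mt (ws X j) in let sk := mt (ws X k) in
     vcomp (wr (wlam X i j) sk) (vcomp (wl sj (wlam X i k)) (wr (wlam X j k) si)) =
     vcomp (wl si (wlam X j k)) (vcomp (wr (wlam X i k) sj) (wl sk (wlam X i j)))).

Record wdln1 (X Y : wdln0) := W1 { wv : hom L (wob X) (wob Y); wxi : nat -> cell L (wob X) (wob Y) }.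
Arguments wv {X Y} _.
Arguments wxi {X Y} _ _.

Definition is_wdln1 (n : nat) {X Y} (F : wdln1 X Y) : Prop :=
  (forall i, i <= n -> mnd1 (ws X i) (ws Y i) (wv F) (wxi F i)) /\
  (forall i j, i < j <= n ->
     wdl1 (ws X j) (ws X i) (wlam X i j) (ws Y j) (ws Y i) (wlam Y i j)
          (wv F) (wxi F j) (wxi F i)).

Definition is_wdln2 (n : nat) {X Y} (F G : wdln1 X Y) (omega : cell L (wob X) (wob Y)) : Prop :=
  forall i, i <= n -> mnd2 (ws X i) (ws Y i) (wv F) (wv G) (wxi F i) (wxi G i) omega.

Definition wid (X : wdln0) : wdln1 X X :=
  W1 X X (id1 (wob X)) (fun i => id2 (mt (ws X i))).

Definition wcomp {X Y Z} (F : wdln1 X Y) (G : wdln1 Y Z) : wdln1 X Z :=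
  W1 X Z (comp1 (wv G) (wv F))
     (fun i => vcomp (wl (wv G) (wxi F i)) (wr (wxi G i) (wv F))).

End Generic.

Arguments mt {L A} _.
Arguments mmu {L A} _.
Arguments meta {L A} _.
Arguments Mon {L A} _ _ _.
Arguments wob {L} _.
Arguments ws {L} _ _.
Arguments wlam {L} _ _ _.
Arguments W0 {L} _ _ _.
Arguments wv {L X Y} _.
Arguments wxi {L X Y} _ _.
Arguments W1 {L} X Y _ _.
Arguments wdln1 {L} X Y.
Arguments typ {L A B} _ _ _.
Arguments wl {L A B D} _ _.
Arguments wr {L A B D} _ _.
Arguments is_monad {L A} _.
Arguments lambar {L A} _ _ _.
Arguments is_wdln0 {L} _ _.
Arguments is_wdln1 {L} _ {X Y} _.
Arguments is_wdln2 {L} _ {X Y} _ _ _.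
Arguments wid {L} _.
Arguments wcomp {L X Y Z} _ _.

Section Ck.
Variable K : PreTwoCat.
Local Notation L := (bar K).

Definition wwp_hom {A} (s t : mon L A) (lam : cell L A A) : hom L A A :=
  (fst (comp1 (mt s) (mt t)), snd (lambar t s lam)).

Definition wwp {A} (s t : mon L A) (lam : cell L A A) : mon L A :=
  let M := wwp_hom s t lam in
  Mon M
    (retype (vcomp (hcomp (mmu s) (mmu t)) (wl (mt s) (wr lam (mt t)))) (comp1 M M) M)
    (retype (vcomp lam (hcomp (meta t) (meta s))) (id1 A) M).

Variable k : nat.
Local Notation p := (k - 1).

(* old index of a new index other than k-1 *)
Definition old (i : nat) : nat := if i <? p then i else S i.

Definition merged (X : wdln0 L) : hom L (wob X) (wob X) :=
  wwp_hom (ws X p) (ws X k) (wlam X p k).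

Definition lbar (X : wdln0 L) : cell L (wob X) (wob X) :=
  lambar (ws X k) (ws X p) (wlam X p k).

Definition Ck_mon (X : wdln0 L) (i : nat) : mon L (wob X) :=
  if i <? p then ws X i
  else if i =? p then wwp (ws X p) (ws X k) (wlam X p k)
  else ws X (S i).

Definition Ck_lam (X : wdln0 L) (i j : nat) : cell L (wob X) (wob X) :=
  let s := fun r => mt (ws X r) in
  let M := merged X in
  if i =? p then
    (* new pair (k-1, j) with k-1 < j : old index j+1 *)
    let j' := S j in
    retype (vcomp (wl (s p) (wlam X k j'))
             (vcomp (wr (wlam X p j') (s k)) (wl (s j') (lbar X))))
           (comp1 (s j') M) (comp1 M (s j'))
  else if j =? p then
    retype (vcomp (wr (wlam X i p) (s k))
             (vcomp (wl (s p) (wlam X i k)) (wr (lbar X) (s i))))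
           (comp1 M (s i)) (comp1 (s i) M)
  else wlam X (old i) (old j).

Definition Ck0 (X : wdln0 L) : wdln0 L := W0 (wob X) (Ck_mon X) (Ck_lam X).

Definition Ck1 (X Y : wdln0 L) (F : wdln1 X Y) : wdln1 (Ck0 X) (Ck0 Y) :=
  W1 (Ck0 X) (Ck0 Y) (wv F)
    (fun i =>
       if i <? p then wxi F i
       else if i =? p then
         retype (vcomp (wl (wv F) (lbar X))
                  (vcomp (wr (wxi F p) (mt (ws X k))) (wl (mt (ws Y p)) (wxi F k))))
                (comp1 (merged Y) (wv F)) (comp1 (wv F) (merged X))
       else wxi F (S i)).

End Ck.

Arguments Ck0 {K} k X.
Arguments Ck1 {K} k {X Y} F.

(* Main.v *)
Require Import Defs.
From Stdlib Require Import Arith Lia ProofIrrelevance FunctionalExtensionality.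

(** Every 1-cell [t : A -> B] of the closure of [K] acts by composition as a functor
    between the categories of 1-cells out of a fixed object [X], and every 2-cell
    as a natural transformation; evaluating at the identity of [X := A] recovers the
    2-cell. It thus suffices to treat monads and weak distributive laws on ordinary
    categories, where horizontal composition is strictly associative by computation and
    the interchange law is naturality. There the composite [b c] of two monads with a
    law [c b -> b c] has an idempotent [wbar], whose splitting [S] is the weak wreath
    product, with monic [inj : S -> b c].

    For a further monad [a] on the left, [Phi : b c a -> a b c] being the composite of
    the given laws, the Yang-Baxter relation gives [a wbar . Phi . wbar a = Phi . wbar a].
    Hence the new law [S a -> a S] satisfies [a inj . law = Phi . inj a], and each axiom
    for it reduces, as [inj] is monic, to an identity about [Phi] precomposed with [wbar].
    The case of a monad [d] on the right, with [Psi : d b c -> b c d], is symmetric.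
    For a 1-cell, the compatibility with the new law is checked first after
    precomposition with the law [c' b' -> b' c'] of the target; since both sides are
    linear over [b'] (or [c']), it extends to precomposition with [wbar]. *)

(** * Monads and weak distributive laws on categories *)

Record Category := {
  obj :> Type;
  arr : obj -> obj -> Type;
  idm : forall x, arr x x;
  cmp : forall x y z, arr y z -> arr x y -> arr x z;
  cmpA : forall w x y z (f : arr y z) (g : arr x y) (h : arr w x),
    cmp _ _ _ (cmp _ _ _ f g) h = cmp _ _ _ f (cmp _ _ _ g h);
  idl : forall x y (f : arr x y), cmp _ _ _ (idm y) f = f;
  idr : forall x y (f : arr x y), cmp _ _ _ f (idm x) = f }.
Arguments arr {C} _ _ : rename.
Arguments idm {C} x : rename.
Arguments cmp {C x y z} _ _ : rename.
Arguments cmpA {C w x y z} _ _ _ : rename.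
Arguments idl {C x y} _ : rename.
Arguments idr {C x y} _ : rename.
Notation "f ∘ g" := (cmp f g) (at level 38, right associativity).

Record Functor (C D : Category) := {
  fob :> C -> D;
  fm : forall x y, arr x y -> arr (fob x) (fob y);
  fm_id : forall x, fm x x (idm x) = idm (fob x);
  fm_cmp : forall x y z (f : arr y z) (g : arr x y),
    fm _ _ (f ∘ g) = fm _ _ f ∘ fm _ _ g }.
Arguments fob {C D} _ _.
Arguments fm {C D} _ {x y} _.
Arguments fm_id {C D} _ x.
Arguments fm_cmp {C D} _ {x y z} _ _.
Notation "F <$> f" := (fm F f) (at level 36, right associativity).

Record Monad (C : Category) := {
  mT :> Functor C C;
  mu : forall x, arr (mT (mT x)) (mT x);
  eta : forall x, arr x (mT x);
  mu_nat : forall x y (f : arr x y), mu y ∘ mT <$> mT <$> f = mT <$> f ∘ mu x;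
  eta_nat : forall x y (f : arr x y), eta y ∘ f = mT <$> f ∘ eta x;
  mu_mu : forall x, mu x ∘ mu (mT x) = mu x ∘ mT <$> mu x;
  mu_eta : forall x, mu x ∘ eta (mT x) = idm (mT x);
  mu_Teta : forall x, mu x ∘ mT <$> eta x = idm (mT x) }.
Arguments mT {C} _.
Arguments mu {C} _ x.
Arguments eta {C} _ x.
Arguments mu_nat {C} _ {x y} f.
Arguments eta_nat {C} _ {x y} f.
Arguments mu_mu {C} _ x.
Arguments mu_eta {C} _ x.
Arguments mu_Teta {C} _ x.

Record Wdl {C} (t s : Monad C) := {
  law :> forall x, arr (t (s x)) (s (t x));
  law_nat : forall x y (f : arr x y), law y ∘ t <$> s <$> f = s <$> t <$> f ∘ law x;
  law_mut : forall x, law x ∘ mu t (s x) = s <$> mu t x ∘ law (t x) ∘ t <$> law x;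
  law_mus : forall x, law x ∘ t <$> mu s x = mu s (t x) ∘ s <$> law x ∘ law (s x);
  law_etat : forall x, law x ∘ eta t (s x) =
    mu s (t x) ∘ s <$> law x ∘ s <$> t <$> eta s x ∘ s <$> eta t x;
  law_etas : forall x, law x ∘ t <$> eta s x =
    s <$> mu t x ∘ law (t x) ∘ eta t (s (t x)) ∘ eta s (t x) }.
Arguments law {C t s} _ x.
Arguments law_nat {C t s} _ {x y} f.
Arguments law_mut {C t s} _ x.
Arguments law_mus {C t s} _ x.
Arguments law_etat {C t s} _ x.
Arguments law_etas {C t s} _ x.

Record MndMor {C D} (t : Monad C) (t' : Monad D) (v : Functor C D) := {
  mor :> forall x, arr (t' (v x)) (v (t x));
  mor_nat : forall x y (f : arr x y), mor y ∘ t' <$> v <$> f = v <$> t <$> f ∘ mor x;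
  mor_mu : forall x, mor x ∘ mu t' (v x) = v <$> mu t x ∘ mor (t x) ∘ t' <$> mor x;
  mor_eta : forall x, mor x ∘ eta t' (v x) = v <$> eta t x }.
Arguments mor {C D t t' v} _ x.
Arguments mor_nat {C D t t' v} _ {x y} f.
Arguments mor_mu {C D t t' v} _ x.
Arguments mor_eta {C D t t' v} _ x.

(** * Rewriting inside composites and under functors *)

Section Lifting.
Context {C D : Category} (F : Functor C D).
Lemma tail2 {w x y z : C} {f : arr y z} {g : arr x y} {r} (E : f ∘ g = r) (h : arr w x) :
  f ∘ g ∘ h = r ∘ h.
Proof. now rewrite <- E, cmpA. Qed.
Lemma tail3 {v w x y z : C} {f : arr y z} {g : arr x y} {k : arr w x} {r}
  (E : f ∘ g ∘ k = r) (h : arr v w) : f ∘ g ∘ k ∘ h = r ∘ h.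
Proof. now rewrite <- E, !cmpA. Qed.
Lemma tail4 {u v w x y z : C} {f : arr y z} {g : arr x y} {k : arr w x} {l : arr v w} {r}
  (E : f ∘ g ∘ k ∘ l = r) (h : arr u v) : f ∘ g ∘ k ∘ l ∘ h = r ∘ h.
Proof. now rewrite <- E, !cmpA. Qed.
Lemma tail5 {t u v w x y z : C} {f : arr y z} {g : arr x y} {k : arr w x} {l : arr v w}
  {m : arr u v} {r} (E : f ∘ g ∘ k ∘ l ∘ m = r) (h : arr t u) :
  f ∘ g ∘ k ∘ l ∘ m ∘ h = r ∘ h.
Proof. now rewrite <- E, !cmpA. Qed.
Lemma fm2 {x y z : C} {f : arr y z} {g : arr x y} {r} (E : f ∘ g = r) :
  F <$> f ∘ F <$> g = F <$> r.
Proof. now rewrite <- E, fm_cmp. Qed.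
Lemma fm3 {w x y z : C} {f : arr y z} {g : arr x y} {k : arr w x} {r}
  (E : f ∘ g ∘ k = r) : F <$> f ∘ F <$> g ∘ F <$> k = F <$> r.
Proof. now rewrite <- E, !fm_cmp. Qed.
Lemma fm4 {v w x y z : C} {f : arr y z} {g : arr x y} {k : arr w x} {l : arr v w} {r}
  (E : f ∘ g ∘ k ∘ l = r) : F <$> f ∘ F <$> g ∘ F <$> k ∘ F <$> l = F <$> r.
Proof. now rewrite <- E, !fm_cmp. Qed.
Lemma fm5 {u v w x y z : C} {f : arr y z} {g : arr x y} {k : arr w x} {l : arr v w}
  {m : arr u v} {r} (E : f ∘ g ∘ k ∘ l ∘ m = r) :
  F <$> f ∘ F <$> g ∘ F <$> k ∘ F <$> l ∘ F <$> m = F <$> r.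
Proof. now rewrite <- E, !fm_cmp. Qed.
End Lifting.

Ltac norm := repeat first
  [rewrite cmpA | rewrite fm_cmp | rewrite idl | rewrite idr | rewrite fm_id].

Lemma nat_fm {C D : Category} (F : Functor C D) {x y y' z : C} {f : arr y z} {g : arr x y}
  {f' : arr y' z} {g' : arr x y'} (E : f ∘ g = f' ∘ g') :
  F <$> f ∘ F <$> g = F <$> f' ∘ F <$> g'.
Proof. now rewrite <- !fm_cmp, E. Qed.
Lemma nat_tail {C : Category} {w x y y' z : C} {f : arr y z} {g : arr x y}
  {f' : arr y' z} {g' : arr x y'} (E : f ∘ g = f' ∘ g') (h : arr w x) :
  f ∘ g ∘ h = f' ∘ g' ∘ h.
Proof. now rewrite <- !cmpA, E. Qed.

Ltac rwd2 n E := first [ rewrite E | rewrite (tail2 E)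
  | match n with S ?m => rwd2 m uconstr:(fm2 _ E) end ].
Ltac rwd3 n E := first [ rewrite E | rewrite (tail3 E)
  | match n with S ?m => rwd3 m uconstr:(fm3 _ E) end ].
Ltac rwd4 n E := first [ rewrite E | rewrite (tail4 E)
  | match n with S ?m => rwd4 m uconstr:(fm4 _ E) end ].
Ltac rwd5 n E := first [ rewrite E | rewrite (tail5 E)
  | match n with S ?m => rwd5 m uconstr:(fm5 _ E) end ].
Ltac lhs_of E k := let e := open_constr:(E) in
  lazymatch type of e with ?t = _ => k t end.

(* [rw E] rewrites with [E] inside a composite, under up to five functors. The number of
   factors on the left of [E] is read off its syntax, since unification would unfold
   definitions to match a longer composite. *)
Tactic Notation "rw" uconstr(E) := first
  [ assert_succeeds (lhs_of E ltac:(fun t => lazymatch t with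
      cmp _ (cmp _ (cmp _ (cmp _ _))) => idtac end)); rwd5 5 E
  | assert_succeeds (lhs_of E ltac:(fun t => lazymatch t with
      cmp _ (cmp _ (cmp _ _)) => idtac end)); rwd4 5 E
  | assert_succeeds (lhs_of E ltac:(fun t => lazymatch t with
      cmp _ (cmp _ _) => idtac end)); rwd3 5 E
  | rwd2 5 E ]; norm.

Definition wbar {C} {t s : Monad C} (l : Wdl t s) x : arr (s (t x)) (s (t x)) :=
  mu s (t x) ∘ s <$> law l x ∘ s <$> t <$> eta s x.

Lemma wbar_nat {C} {t s : Monad C} (l : Wdl t s) {x y} (f : arr x y) :
  wbar l y ∘ s <$> t <$> f = s <$> t <$> f ∘ wbar l x.
Proof.
  unfold wbar; norm.
  rw (eta_nat s f).
  rw (law_nat l _). rw (mu_nat s _). reflexivity.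
Qed.

(** The splitting is carried as data, natural in [x], because an idempotent of an arbitrary category
    need not split; [homsplit] provides it on the hom-categories of the closure. *)
Record Splitting {C} {t s : Monad C} (l : Wdl t s) := {
  sM :> Functor C C;
  inj : forall x, arr (sM x) (s (t x));
  prj : forall x, arr (s (t x)) (sM x);
  inj_nat : forall x y (f : arr x y), inj y ∘ sM <$> f = s <$> t <$> f ∘ inj x;
  prj_nat : forall x y (f : arr x y), prj y ∘ s <$> t <$> f = sM <$> f ∘ prj x;
  prj_inj : forall x, prj x ∘ inj x = idm (sM x);
  inj_prj : forall x, inj x ∘ prj x = wbar l x }.
Arguments sM {C t s l} _.
Arguments inj {C t s l} _ x.
Arguments prj {C t s l} _ x.
Arguments inj_nat {C t s l} _ {x y} f.
Arguments prj_nat {C t s l} _ {x y} f.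
Arguments prj_inj {C t s l} _ x.
Arguments inj_prj {C t s l} _ x.

(* [nf] and [nfr] use naturality to bring a pasting of 2-cells to a normal form: [nf]
   performs cells further to the left first, [nfr] cells further to the right. *)
Ltac nat_pf A B :=
  lazymatch A with
  | fm ?F ?A' => lazymatch B with fm _ ?B' =>
       let p := nat_pf A' B' in constr:(nat_fm F p) end
  | eta ?b _ => constr:(eta_nat b B)
  | inj ?S _ => lazymatch B with fm _ ?f => constr:(inj_nat S f) end
  | mu ?b _ => lazymatch B with fm _ (fm _ ?f) => constr:(mu_nat b f) end
  | law ?l _ => lazymatch B with fm _ (fm _ ?f) => constr:(law_nat l f) end
  | mor ?l _ => lazymatch B with fm _ (fm _ ?f) => constr:(mor_nat l f) end
  | wbar ?l _ => lazymatch B with fm _ (fm _ ?f) => constr:(wbar_nat l f) end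
  | prj ?S _ => lazymatch B with fm _ (fm _ ?f) => constr:(prj_nat S f) end
  end.
Ltac nat1 :=
  match goal with
  | |- context [cmp ?A (cmp ?B _)] => let p := nat_pf A B in rewrite (nat_tail p)
  | |- context [cmp ?A ?B] => let p := nat_pf A B in rewrite p
  end.
Ltac nf := norm; repeat nat1; norm.

Ltac nat_pfr A B :=
  lazymatch B with
  | fm ?F ?B' => lazymatch A with fm _ ?A' =>
       let p := nat_pfr A' B' in constr:(nat_fm F p) end
  | eta ?b _ => lazymatch A with fm _ ?f => constr:(eq_sym (eta_nat b f)) end
  | inj ?S _ => lazymatch A with fm _ (fm _ ?f) => constr:(eq_sym (inj_nat S f)) end
  | mu ?b _ => lazymatch A with fm _ ?f => constr:(eq_sym (mu_nat b f)) end
  | law ?l _ => lazymatch A with fm _ (fm _ ?f) => constr:(eq_sym (law_nat l f)) end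
  | mor ?l _ => lazymatch A with fm _ (fm _ ?f) => constr:(eq_sym (mor_nat l f)) end
  | wbar ?l _ => lazymatch A with fm _ (fm _ ?f) => constr:(eq_sym (wbar_nat l f)) end
  | prj ?S _ => lazymatch A with fm _ ?f => constr:(eq_sym (prj_nat S f)) end
  end.
Ltac nat1r :=
  match goal with
  | |- context [cmp ?A (cmp ?B _)] => let p := nat_pfr A B in rewrite (nat_tail p)
  | |- context [cmp ?A ?B] => let p := nat_pfr A B in rewrite p
  end.
Ltac nfr := norm; repeat nat1r; norm.

Tactic Notation "rwl" uconstr(E) := rw (eq_sym E).

(** * The idempotent of a law and the product on [b c] before splitting *)

Section Wreath.
Context {C : Category} {c b : Monad C} (l : Wdl c b).

(** Applying both unit axioms in turn to the right-hand side inserts a unit of [c], which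
    associativity cancels against the outer multiplication; the second unit axiom brings the
    definition of [wbar] to the same form. *)
Lemma wbar_alt x : wbar l x = b <$> mu c x ∘ law l (c x) ∘ eta c (b (c x)).
Proof.
  rw (law_etat l (c x)). rw (law_etas l (c x)).
  rw (mu_nat b (mu c (c x))). rw (mu_mu c x). nf. rw (mu_eta c x).
  unfold wbar. rw (law_etas l x). nf. reflexivity.
Qed.

(** By naturality the unit of [b] in [wbar] can be performed before the law; multiplicativity in [b]
    then merges the two laws, and the unit cancels against the multiplication of [b]. *)
Lemma wbar_law x : wbar l x ∘ l x = l x.
Proof.
  unfold wbar; nfr. rwl (law_mus l x). rw (mu_Teta b x). reflexivity.
Qed.

(** Each formula for the idempotent shows one linearity. The definition ends with a multiplication
    of [b], so associativity of [b] gives this one; [wbar_mut] uses [wbar_alt] in the same way for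
    [c]. *)
Lemma wbar_mus x : wbar l x ∘ mu b (c x) = mu b (c x) ∘ b <$> wbar l x.
Proof. unfold wbar; norm. rwl (mu_mu b (c x)). nf. reflexivity. Qed.

Lemma wbar_mut x : wbar l x ∘ b <$> mu c x = b <$> mu c x ∘ wbar l (c x).
Proof. rewrite !wbar_alt; nf. rwl (mu_mu c x). nf. reflexivity. Qed.

Lemma wbar_idem x : wbar l x ∘ wbar l x = wbar l x.
Proof.
  (* The factor performed first is expanded; the other one passes its multiplication and is absorbed
     by the law. *)
  unfold wbar at 2. norm. rw (wbar_mus x). rw (wbar_law x). reflexivity.
Qed.

Lemma wbar_etas x : wbar l x ∘ eta b (c x) = l x ∘ c <$> eta b x.
Proof. unfold wbar. nfr. rw (mu_eta b (c x)). reflexivity. Qed.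

Lemma wbar_etat x : wbar l x ∘ b <$> eta c x = l x ∘ eta c (b x).
Proof. rewrite wbar_alt; nf. rw (mu_Teta c x). reflexivity. Qed.

(** The weak wreath multiplication before splitting. It is associative on [b c] itself, whereas
    [wunit] is a unit for it only up to [wbar]. *)
Definition wmul x : arr (b (c (b (c x)))) (b (c x)) :=
  mu b (c x) ∘ b <$> b <$> mu c x ∘ b <$> l (c x).
Definition wunit x : arr x (b (c x)) := l x ∘ eta c (b x) ∘ eta b x.

Lemma wmul_nat {x y} (f : arr x y) :
  wmul y ∘ b <$> c <$> b <$> c <$> f = b <$> c <$> f ∘ wmul x.
Proof. unfold wmul; nf. reflexivity. Qed.

Lemma wunit_nat {x y} (f : arr x y) : wunit y ∘ f = b <$> c <$> f ∘ wunit x.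
Proof. unfold wunit; nf. reflexivity. Qed.

(** [wbar] is absorbed by [wmul] at the output and, by the next two lemmas, at either input. These
    rules make [wmul] descend to the splitting with [wunit] as its unit. *)
Lemma wbar_wmul x : wbar l x ∘ wmul x = wmul x.
Proof.
  unfold wmul. norm. rw (wbar_mus x). rw (wbar_mut x). rw (wbar_law (c x)). reflexivity.
Qed.

Lemma wmul_wbar x : wmul x ∘ wbar l (b (c x)) = wmul x.
Proof.
  unfold wmul, wbar. nfr. rw (mu_mu b (c x)). nf.
  rwl (law_mus l (c x)). rw (mu_eta b (c x)). reflexivity.
Qed.

Lemma wmul_bcwbar x : wmul x ∘ b <$> c <$> wbar l x = wmul x.
Proof.
  rewrite wbar_alt. unfold wmul. nf. rwl (mu_mu c x). nfr. rwl (law_mut l (c x)).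
  rw (mu_Teta c (b (c x))). nf. reflexivity.
Qed.

(** As for ordinary distributive laws: multiplicativity in [b] and in [c] separates the two
    products, and each is associative. *)
Lemma wmul_wmul x : wmul x ∘ wmul (b (c x)) = wmul x ∘ b <$> c <$> wmul x.
Proof.
  unfold wmul. norm. rw (law_mus l (c x)). rwl (mu_nat b (l (c x))).
  rw (law_mut l (c x)). nf. rwl (mu_mu b _). rw (mu_mu c x). nf. reflexivity.
Qed.

(** In this form [wunit] is [wbar] on the plain units, and [wmul] absorbs that [wbar] in both unit
    laws. *)
Lemma wunit_alt x : wunit x = wbar l x ∘ eta b (c x) ∘ eta c x.
Proof. rw (wbar_etas x). unfold wunit. nf. reflexivity. Qed.

Lemma wbar_wunit x : wbar l x ∘ wunit x = wunit x.
Proof. unfold wunit. rw (wbar_law x). reflexivity. Qed.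

Lemma wmul_wunit x : wmul x ∘ wunit (b (c x)) = wbar l x.
Proof.
  rewrite wunit_alt. rw (wmul_wbar x). rewrite wbar_alt. unfold wmul. nfr.
  rw (mu_eta b (c x)). reflexivity.
Qed.

Lemma wmul_bcwunit x : wmul x ∘ b <$> c <$> wunit x = wbar l x.
Proof.
  rewrite wunit_alt. norm. rw (wmul_bcwbar x). unfold wbar, wmul. nf.
  rw (mu_Teta c x). reflexivity.
Qed.
End Wreath.

(** * The weak wreath product as a monad on the splitting *)

Section WreathMonad.
Context {C : Category} {c b : Monad C} {l : Wdl c b} (S : Splitting l).

Lemma inj_monic {x y} (f g : arr x (S y)) : inj S y ∘ f = inj S y ∘ g -> f = g.
Proof.
  intros E. rewrite <- (idl f), <- (idl g), <- (prj_inj S y), !cmpA, E. reflexivity.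
Qed.

Lemma fm_inj_monic {D} (F : Functor C D) {x y} (f g : arr x (F (S y))) :
  F <$> inj S y ∘ f = F <$> inj S y ∘ g -> f = g.
Proof.
  intros E. rewrite <- (idl f), <- (idl g), <- fm_id, <- (prj_inj S y), fm_cmp, !cmpA, E.
  reflexivity.
Qed.

Lemma fm_inj_monic2 {D E} (G : Functor D E) (F : Functor C D) {x y} (f g : arr x (G (F (S y)))) :
  G <$> F <$> inj S y ∘ f = G <$> F <$> inj S y ∘ g -> f = g.
Proof.
  intros H. rewrite <- (idl f), <- (idl g), <- fm_id, <- fm_id, <- (prj_inj S y),
    !fm_cmp, !cmpA, H.
  reflexivity.
Qed.

Lemma wbar_inj x : wbar l x ∘ inj S x = inj S x.
Proof. rewrite <- (inj_prj S x). norm. rw (prj_inj S x). reflexivity. Qed.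

Definition smul x : arr (S (S x)) (S x) :=
  prj S x ∘ wmul l x ∘ b <$> c <$> inj S x ∘ inj S (S x).
Definition sunit x : arr x (S x) := prj S x ∘ wunit l x.

Lemma inj_smul x : inj S x ∘ smul x = wmul l x ∘ b <$> c <$> inj S x ∘ inj S (S x).
Proof. unfold smul. rw (inj_prj S x). rw (wbar_wmul l x). reflexivity. Qed.
Lemma inj_sunit x : inj S x ∘ sunit x = wunit l x.
Proof. unfold sunit. rw (inj_prj S x). rw (wbar_wunit l x). reflexivity. Qed.

(** Kept transparent: the functor, multiplication and unit must later compute to [S], [smul] and
    [sunit]. *)
Definition wreath : Monad C.
Proof.
  refine {| mT := S; mu := smul; eta := sunit |}.
  - intros x y f. apply inj_monic. rw (inj_smul y). rw (inj_nat S f). rw (inj_smul x).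
    nf. rw (wmul_nat l f). reflexivity.
  - intros x y f. apply inj_monic. rw (inj_sunit y). rw (inj_nat S f). rw (inj_sunit x).
    apply wunit_nat.
  - intros x. apply inj_monic. rw (inj_smul x). rw (inj_smul _). nf.
    rw (inj_smul x). rwl (wmul_nat l (inj S x)). rw (wmul_wmul l x).
    nf. rw (inj_smul x). reflexivity.
  - intros x. apply inj_monic. rw (inj_smul x). rw (inj_sunit _).
    rwl (wunit_nat l (inj S x)). rw (wmul_wunit l x). apply wbar_inj.
  - intros x. apply inj_monic. rw (inj_smul x). nf. rw (inj_sunit x).
    rw (wmul_bcwunit l x). apply wbar_inj.
Defined.
End WreathMonad.

Definition YangBaxter {C} {i j k : Monad C} (lij : Wdl j i) (lik : Wdl k i) (ljk : Wdl k j) :=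
  forall x, lij (k x) ∘ j <$> lik x ∘ ljk (i x) = i <$> ljk x ∘ lik (j x) ∘ k <$> lij x.

(** * Distributing the weak wreath product over a third monad *)

Section LeftDistribution.
Context {C : Category} {c b a : Monad C} (l : Wdl c b) (lab : Wdl b a) (lac : Wdl c a).
Context (yb : YangBaxter lab lac l).

(** Multiplicativity of [lab] lets the product of [b] inside [wbar] come last, and Yang-Baxter puts
    [l] after the [c]-law. In the resulting form a further [wbar] slides back to [l] and is absorbed
    there, which proves [wbar_Phi_wbar]. *)
Lemma Phi_wbar x : lab (c x) ∘ b <$> lac x ∘ wbar l (a x) =
  a <$> mu b (c x) ∘ lab (b (c x)) ∘ b <$> a <$> l x ∘ b <$> lac (b x) ∘
  b <$> c <$> lab x ∘ b <$> c <$> eta b (a x).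
Proof.
  unfold wbar. nfr. rw (law_mut lab (c x)). rw (yb x). reflexivity.
Qed.

Lemma wbar_Phi_wbar x : a <$> wbar l x ∘ lab (c x) ∘ b <$> lac x ∘ wbar l (a x) =
  lab (c x) ∘ b <$> lac x ∘ wbar l (a x).
Proof.
  rw (Phi_wbar x). rw (wbar_mus l x). nfr. rw (wbar_law l x). nfr. reflexivity.
Qed.

Lemma Phi_mul x : lab (c x) ∘ b <$> lac x ∘ wmul l (a x) =
  a <$> wmul l x ∘ lab (c (b (c x))) ∘ b <$> lac (b (c x)) ∘
  b <$> c <$> lab (c x) ∘ b <$> c <$> b <$> lac x.
Proof.
  unfold wmul. norm. rwl (mu_nat b (lac x)). rw (law_mut lab (c x)).
  rw (law_mut lac x). nf. rwl (law_nat l (lac x)). rw (yb (c x)). nf. reflexivity.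
Qed.

Lemma Phi_mua x : lab (c x) ∘ b <$> lac x ∘ b <$> c <$> mu a x =
  mu a (b (c x)) ∘ a <$> lab (c x) ∘ a <$> b <$> lac x ∘ lab (c (a x)) ∘ b <$> lac (a x).
Proof.
  rw (law_mus lac x). rw (law_mus lab (c x)). nf. reflexivity.
Qed.

(** Yang-Baxter moves [l] to the end on both sides; the first unit axioms of [lab] and [lac] then
    give the same factors with two products of [a], which agree by associativity. *)
Lemma Phi_wunit x : lab (c x) ∘ b <$> lac x ∘ wunit l (a x) =
  mu a (b (c x)) ∘ a <$> lab (c x) ∘ a <$> b <$> lac x ∘ a <$> b <$> c <$> eta a x ∘
  a <$> wunit l x.
Proof.
  unfold wunit. nfr. rw (yb x). nfr. rw (law_etat lab x).
  rw (yb x). rwl (eta_nat c (lab x)). rw (law_etat lac (b x)). rw (law_etat lac (b x)).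
  nfr. rw (mu_mu a _). nfr. reflexivity.
Qed.

(** By its second unit axiom, [lac] on the unit of [a] ends with a product of [c], so associativity
    of [c] lets a further product through. *)
Lemma Phi_eta_muc x : lab (c x) ∘ b <$> lac x ∘ b <$> c <$> eta a x ∘ b <$> mu c x =
  a <$> b <$> mu c x ∘ lab (c (c x)) ∘ b <$> lac (c x) ∘ b <$> c <$> eta a (c x).
Proof.
  rw (law_etas lac x). rw (law_etas lac (c x)). nf. rw (mu_mu c x). nf. reflexivity.
Qed.

(** Yang-Baxter exposes [lab] on the unit of [a]. There the second unit axiom produces a product
    with a unit of [b], [l] splits over that product, and Yang-Baxter in reverse restores the two
    laws, with the unit now inside [wbar]. *)
Lemma Phi_eta_mub x :
  lab (c x) ∘ b <$> lac x ∘ b <$> c <$> eta a x ∘ mu b (c x) ∘ b <$> l x =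
  a <$> mu b (c x) ∘ a <$> b <$> l x ∘ lab (c (b x)) ∘ b <$> lac (b x) ∘
  b <$> c <$> eta a (b x) ∘ wbar l (b x).
Proof.
  unfold wbar. nfr. rw (law_mut lab (c x)). rw (yb x).
  rw (law_etas lab x). nf. rw (law_mus l x). rwl (law_nat lab (l (b x))).
  rwl (yb (b x)). nfr. rw (law_mut lab _). nf. rwl (mu_mu b (c x)). nf. reflexivity.
Qed.

Lemma Phi_eta_wmul x : lab (c x) ∘ b <$> lac x ∘ b <$> c <$> eta a x ∘ wmul l x =
  a <$> wmul l x ∘ lab (c (b (c x))) ∘ b <$> lac (b (c x)) ∘
  b <$> c <$> eta a (b (c x)) ∘ wbar l (b (c x)).
Proof.
  unfold wmul. norm. rw (mu_nat b (mu c x)). rw (Phi_eta_muc x). rw (Phi_eta_mub (c x)).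
  rw (mu_nat b (mu c x)). reflexivity.
Qed.

(** This is [Phi_eta_wmul] evaluated on [wunit] in the first factor, where [wmul] leaves [wbar]. It
    becomes the second unit axiom of the new law after splitting. *)
Lemma Phi_eta_wbar x : lab (c x) ∘ b <$> lac x ∘ b <$> c <$> eta a x ∘ wbar l x =
  a <$> wmul l x ∘ lab (c (b (c x))) ∘ b <$> lac (b (c x)) ∘
  wunit l (a (b (c x))) ∘ eta a (b (c x)) ∘ wbar l x.
Proof.
  rw (wunit_nat l (eta a (b (c x)))). rwl (wbar_wunit l (b (c x))).
  rwl (Phi_eta_wmul x). rw (wmul_wunit l x). rw (wbar_idem l x). reflexivity.
Qed.

Context (S : Splitting l).

Definition lwdl_law x : arr (S (a x)) (a (S x)) :=
  a <$> prj S x ∘ lab (c x) ∘ b <$> lac x ∘ inj S (a x).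

Lemma inj_lwdl_law x :
  a <$> inj S x ∘ lwdl_law x = lab (c x) ∘ b <$> lac x ∘ inj S (a x).
Proof.
  unfold lwdl_law. rw (inj_prj S x). rewrite <- (wbar_inj S (a x)).
  rw (wbar_Phi_wbar x). reflexivity.
Qed.

Definition lwdl : Wdl (wreath S) a.
Proof.
  refine {| law := lwdl_law : forall x, arr (wreath S (a x)) (a (wreath S x)) |};
    cbn [wreath mT mu eta]; intros x.
  - intros y f. apply (fm_inj_monic S). rw (inj_lwdl_law y). nf. rw (inj_lwdl_law x).
    nf. reflexivity.
  - apply (fm_inj_monic S). rw (inj_lwdl_law x). rw (inj_smul S (a x)).
    rw (Phi_mul x). rw (inj_smul S x). nf. rw (inj_lwdl_law _). nfr. rw (inj_lwdl_law x).
    nf. reflexivity.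
  - apply (fm_inj_monic S). rw (inj_lwdl_law x). nf.
    rw (Phi_mua x). nfr. rw (inj_lwdl_law x). nf. rw (inj_lwdl_law _). nf.
    reflexivity.
  - apply (fm_inj_monic S). rw (inj_lwdl_law x). rw (inj_sunit S (a x)).
    rw (Phi_wunit x). nfr. rw (inj_lwdl_law x). nf. rw (inj_sunit S x). reflexivity.
  - apply (fm_inj_monic S). rw (inj_lwdl_law x). nf. rewrite <- (wbar_inj S x).
    rw (Phi_eta_wbar x). rw (inj_smul S x). rw (inj_lwdl_law _). nf.
    rw (inj_sunit S _). rw (wbar_inj S x). rw (wbar_wmul l x). nfr.
    rwl (wunit_nat l (a <$> inj S x)). nfr. reflexivity.
Defined.
End LeftDistribution.

(** * The mirror image: the law moving a monad on the right past the weak wreath product *)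

Section RightDistribution.
Context {C : Category} {d c b : Monad C} (l : Wdl c b) (lbd : Wdl d b) (lcd : Wdl d c).
Context (yb : YangBaxter l lbd lcd).

(** Mirror image of [Phi_wbar]. The idempotent is taken in its second form, so that multiplicativity
    in [c] plays the part of multiplicativity in [b]. *)
Lemma Psi_wbar x : b <$> lcd x ∘ lbd (c x) ∘ d <$> wbar l x =
  b <$> mu c (d x) ∘ b <$> c <$> lcd x ∘ l (d (c x)) ∘ c <$> lbd (c x) ∘
  lcd (b (c x)) ∘ d <$> eta c (b (c x)).
Proof.
  rewrite wbar_alt. norm. rw (law_nat lbd (mu c x)). rw (law_mus lcd x). rwl (yb (c x)).
  reflexivity.
Qed.

Lemma wbar_Psi_wbar x : wbar l (d x) ∘ b <$> lcd x ∘ lbd (c x) ∘ d <$> wbar l x =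
  b <$> lcd x ∘ lbd (c x) ∘ d <$> wbar l x.
Proof.
  rw (Psi_wbar x). rw (wbar_mut l (d x)). rw (wbar_nat l (lcd x)). rw (wbar_law l _).
  reflexivity.
Qed.

Lemma Psi_mul x : b <$> lcd x ∘ lbd (c x) ∘ d <$> wmul l x =
  wmul l (d x) ∘ b <$> c <$> b <$> lcd x ∘ b <$> c <$> lbd (c x) ∘
  b <$> lcd (b (c x)) ∘ lbd (c (b (c x))).
Proof.
  unfold wmul. norm. rw (law_mus lbd (c x)). nf. rw (law_mus lcd x). rw (yb (c x)). nf.
  reflexivity.
Qed.

Lemma Psi_mud x : b <$> lcd x ∘ lbd (c x) ∘ mu d (b (c x)) =
  b <$> c <$> mu d x ∘ b <$> lcd (d x) ∘ lbd (c (d x)) ∘ d <$> b <$> lcd x ∘ d <$> lbd (c x).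
Proof.
  rw (law_mut lbd (c x)). rw (law_mut lcd x). nf. reflexivity.
Qed.

Lemma Psi_wunit x : b <$> lcd x ∘ lbd (c x) ∘ d <$> wunit l x =
  b <$> c <$> mu d x ∘ b <$> lcd (d x) ∘ lbd (c (d x)) ∘ eta d (b (c (d x))) ∘
  wunit l (d x).
Proof.
  unfold wunit. norm. rwl (yb x). rw (law_etas lcd (b x)). nf. rwl (yb (d x)). nf.
  rw (law_etas lbd x). rw (law_etas lbd (d x)). nf. rw (mu_mu d x). nf. reflexivity.
Qed.

Lemma Psi_eta_mub x : b <$> lcd x ∘ lbd (c x) ∘ eta d (b (c x)) ∘ mu b (c x) =
  mu b (c (d x)) ∘ b <$> b <$> lcd x ∘ b <$> lbd (c x) ∘ b <$> eta d (b (c x)).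
Proof.
  rw (law_etat lbd (c x)). rw (law_etat lbd (c x)). nfr. rw (mu_mu b _). nfr. reflexivity.
Qed.

(** Mirror image of [Phi_eta_mub]: the unit of [c] inside [wbar] is matched by the one that the
    first unit axiom of [lcd] produces. *)
Lemma Psi_eta_muc x :
  b <$> lcd x ∘ lbd (c x) ∘ eta d (b (c x)) ∘ b <$> mu c x ∘ l (c x) =
  b <$> mu c (d x) ∘ l (c (d x)) ∘ c <$> b <$> lcd x ∘ c <$> lbd (c x) ∘
  c <$> eta d (b (c x)) ∘ c <$> wbar l x.
Proof.
  rewrite wbar_alt. nf. rw (law_mus lcd x). rwl (yb (c x)). rw (law_etat lcd (b (c x))).
  nf. rwl (mu_nat c (lbd (c x))). rw (law_mut l (d (c x))). rw (yb (c x)).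
  rw (law_mus lcd x). nf. rwl (mu_mu c (d x)). nf. reflexivity.
Qed.

Lemma Psi_eta_wmul x : b <$> lcd x ∘ lbd (c x) ∘ eta d (b (c x)) ∘ wmul l x =
  wmul l (d x) ∘ b <$> c <$> b <$> lcd x ∘ b <$> c <$> lbd (c x) ∘
  b <$> c <$> eta d (b (c x)) ∘ b <$> c <$> wbar l x.
Proof.
  unfold wmul. norm. rw (Psi_eta_mub x). rw (Psi_eta_muc x). reflexivity.
Qed.

Lemma Psi_eta_wbar x : b <$> lcd x ∘ lbd (c x) ∘ eta d (b (c x)) ∘ wbar l x =
  wmul l (d x) ∘ b <$> c <$> b <$> lcd x ∘ b <$> c <$> lbd (c x) ∘
  b <$> c <$> d <$> wunit l x ∘ b <$> c <$> eta d x ∘ wbar l x.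
Proof.
  rwl (eta_nat d (wunit l x)). rwl (wbar_wunit l x).
  rwl (Psi_eta_wmul x). rw (wmul_bcwunit l x). rw (wbar_idem l x). reflexivity.
Qed.

Context (S : Splitting l).

Definition rwdl_law x : arr (d (S x)) (S (d x)) :=
  prj S (d x) ∘ b <$> lcd x ∘ lbd (c x) ∘ d <$> inj S x.

Lemma inj_rwdl_law x :
  inj S (d x) ∘ rwdl_law x = b <$> lcd x ∘ lbd (c x) ∘ d <$> inj S x.
Proof.
  unfold rwdl_law. rw (inj_prj S _). rewrite <- (wbar_inj S x). norm.
  rw (wbar_Psi_wbar x). reflexivity.
Qed.

Definition rwdl : Wdl d (wreath S).
Proof.
  refine {| law := rwdl_law : forall x, arr (d (wreath S x)) (wreath S (d x)) |};
    cbn [wreath mT mu eta]; intros x.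
  - intros y f. apply (inj_monic S). rw (inj_rwdl_law y). nf. rw (inj_rwdl_law x).
    nf. reflexivity.
  - apply (inj_monic S). rw (inj_rwdl_law x). rwl (mu_nat d (inj S x)).
    rw (Psi_mud x). nf. rw (inj_rwdl_law _). nf. rw (inj_rwdl_law x). nf. reflexivity.
  - apply (inj_monic S). rw (inj_rwdl_law x). rw (inj_smul S x). rw (Psi_mul x).
    rw (inj_smul S _). nf. rw (inj_rwdl_law x). rw (inj_rwdl_law _). nf. reflexivity.
  - apply (inj_monic S). rw (inj_rwdl_law x). rwl (eta_nat d (inj S x)).
    rewrite <- (wbar_inj S x). rw (Psi_eta_wbar x). rw (inj_smul S _). nf.
    rw (inj_rwdl_law x). nf. rw (inj_sunit S x). rw (wbar_inj S x).
    reflexivity.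
  - apply (inj_monic S). rw (inj_rwdl_law x). rw (inj_sunit S x).
    rw (Psi_wunit x). nf. rw (inj_rwdl_law _). nf. rw (inj_sunit S (d x)). nf. reflexivity.
Defined.

End RightDistribution.

(** * The Yang-Baxter relation for the new laws *)

Section YangBaxterWreath.
Context {C : Category} {c b : Monad C} {l : Wdl c b} (S : Splitting l).

(** After composition with [inj] both sides consist of given laws only, and the relation follows
    from those for [b] and for [c], used one after the other. The other two positions of the merged
    monad are treated alike. *)
Lemma yb_left_left {a1 a2 : Monad C} {l12 : Wdl a2 a1}
  {l1b : Wdl b a1} {l1c : Wdl c a1} {l2b : Wdl b a2} {l2c : Wdl c a2}
  (y1 : YangBaxter l1b l1c l) (y2 : YangBaxter l2b l2c l)
  (yb : YangBaxter l12 l1b l2b) (yc : YangBaxter l12 l1c l2c) :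
  YangBaxter l12 (lwdl l l1b l1c y1 S) (lwdl l l2b l2c y2 S).
Proof.
  intros x. cbn [wreath mT lwdl law]. apply (fm_inj_monic2 S).
  nfr. rw (inj_lwdl_law l l1b l1c y1 S x). nf. rw (inj_lwdl_law l l2b l2c y2 S _).
  rw (inj_lwdl_law l l2b l2c y2 S x). nf. rw (inj_lwdl_law l l1b l1c y1 S _). nf.
  rwl (law_nat l2b (l1c x)). rw (yb (c x)). rw (yc x). nf. reflexivity.
Qed.

Lemma yb_left_right {a d : Monad C} {lad : Wdl d a}
  {lab : Wdl b a} {lac : Wdl c a} {lbd : Wdl d b} {lcd : Wdl d c}
  (y1 : YangBaxter lab lac l) (y2 : YangBaxter l lbd lcd)
  (yb : YangBaxter lab lad lbd) (yc : YangBaxter lac lad lcd) :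
  YangBaxter (lwdl l lab lac y1 S) lad (rwdl l lbd lcd y2 S).
Proof.
  intros x. cbn [wreath mT lwdl rwdl law]. apply (fm_inj_monic S).
  rw (inj_lwdl_law l lab lac y1 S _). rw (inj_rwdl_law l lbd lcd y2 S x). nf.
  rw (inj_rwdl_law l lbd lcd y2 S _).
  rwl (law_nat lad (inj S x)). rw (inj_lwdl_law l lab lac y1 S x). rw (yc x).
  rwl (law_nat lbd (lac x)). rw (law_nat lab (lcd x)). rw (yb (c x)). nf. reflexivity.
Qed.

Lemma yb_right_right {d1 d2 : Monad C} {l12 : Wdl d2 d1}
  {lb1 : Wdl d1 b} {lc1 : Wdl d1 c} {lb2 : Wdl d2 b} {lc2 : Wdl d2 c}
  (y1 : YangBaxter l lb1 lc1) (y2 : YangBaxter l lb2 lc2)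
  (yb : YangBaxter lb1 lb2 l12) (yc : YangBaxter lc1 lc2 l12) :
  YangBaxter (rwdl l lb1 lc1 y1 S) (rwdl l lb2 lc2 y2 S) l12.
Proof.
  intros x. cbn [wreath mT lwdl rwdl law]. apply (inj_monic S).
  rw (inj_rwdl_law l lb1 lc1 y1 S _). nf. rw (inj_rwdl_law l lb2 lc2 y2 S _).
  rw (inj_rwdl_law l lb2 lc2 y2 S _). rw (inj_rwdl_law l lb1 lc1 y1 S _).
  rwl (law_nat l12 (inj S x)). rw (law_nat lb1 (lc2 x)). rw (yb (c x)). rw (yc x).
  nf. reflexivity.
Qed.
End YangBaxterWreath.

(** * One-cells *)

Definition WdlMor {C D} {t s : Monad C} (l : Wdl t s) {t' s' : Monad D} (l' : Wdl t' s')
  {v : Functor C D} (xt : MndMor t t' v) (xs : MndMor s s' v) :=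
  forall x, v <$> l x ∘ xt (s x) ∘ t' <$> xs x =
    v <$> wbar l x ∘ xs (t x) ∘ s' <$> xt x ∘ l' (v x).

Section WreathMor.
Context {C D : Category} {c b : Monad C} {l : Wdl c b} {c' b' : Monad D} {l' : Wdl c' b'}
  {v : Functor C D} {xc : MndMor c c' v} {xb : MndMor b b' v} (E : WdlMor l l' xc xb).

(** Once the target idempotent is expanded, the product of [b'] passes [xb], and [E] read backwards
    trades [l'] for [l]; the unit of [b'] becomes that of [b], and a single source idempotent
    remains. This is why the formula for the merged 1-cell carries an idempotent on one side
    only. *)
Lemma wbar_Xi_wbar x : v <$> wbar l x ∘ xb (c x) ∘ b' <$> xc x ∘ wbar l' (v x) =
  v <$> wbar l x ∘ xb (c x) ∘ b' <$> xc x.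
Proof.
  unfold wbar at 2. norm. rwl (mu_nat b' (xc x)). rw (mor_mu xb (c x)). rw (wbar_mus l x).
  rwl (mor_nat xb (wbar l x)). rwl (E x). rw (mor_eta xb x). rw (mor_nat xc (eta b x)).
  nf. unfold wbar. norm. reflexivity.
Qed.

Lemma wbar_Xi_wmul x : v <$> wbar l x ∘ xb (c x) ∘ b' <$> xc x ∘ wmul l' (v x) =
  v <$> wmul l x ∘ xb (c (b (c x))) ∘ b' <$> xc (b (c x)) ∘
  b' <$> c' <$> xb (c x) ∘ b' <$> c' <$> b' <$> xc x.
Proof.
  unfold wmul. norm. rwl (mu_nat b' (xc x)). rw (mor_mu xb (c x)). rw (mor_mu xc x).
  rw (wbar_mus l x). rwl (mor_nat xb (wbar l x)). rw (mor_nat xb (mu c x)).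
  rw (wbar_mut l x). rwl (law_nat l' (xc x)). rwl (E (c x)). nf. reflexivity.
Qed.

Lemma wbar_Xi_wunit x : v <$> wbar l x ∘ xb (c x) ∘ b' <$> xc x ∘ wunit l' (v x) =
  v <$> wunit l x.
Proof.
  rewrite wunit_alt. rw (wbar_Xi_wbar x). nfr. rw (mor_eta xc x). nf. rw (mor_eta xb _).
  rewrite wunit_alt. nf. reflexivity.
Qed.

Context (S : Splitting l) (S' : Splitting l').

Definition wmor_fun x : arr (S' (v x)) (v (S x)) :=
  v <$> prj S x ∘ xb (c x) ∘ b' <$> xc x ∘ inj S' (v x).

Lemma inj_wmor_fun x : v <$> inj S x ∘ wmor_fun x =
  v <$> wbar l x ∘ xb (c x) ∘ b' <$> xc x ∘ inj S' (v x).
Proof. unfold wmor_fun. rw (inj_prj S x). reflexivity. Qed.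

Definition wmor : MndMor (wreath S) (wreath S') v.
Proof.
  refine {| mor := wmor_fun : forall x, arr (wreath S' (v x)) (v (wreath S x)) |};
    cbn [wreath mT mu eta]; intros x.
  - intros y f. apply (fm_inj_monic S). rw (inj_wmor_fun y). nf. rw (inj_wmor_fun x). nf.
    reflexivity.
  - apply (fm_inj_monic S). rw (inj_wmor_fun x). rw (inj_smul S' _). rw (inj_smul S _).
    (* Each of the two copies of [wmor_fun] contributes one [wbar], which [wmul] absorbs at the
       corresponding input. *)
    rw (wbar_Xi_wmul x). rw (inj_wmor_fun (S x)). rwl (wbar_nat l (inj S x)).
    rw (wmul_wbar l x). rw (inj_nat S' (wmor_fun x)). rwl (mor_nat xb (c <$> inj S x)).
    rwl (mor_nat xc (inj S x)). rw (inj_wmor_fun x). rw (mor_nat xc (wbar l x)).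
    rw (mor_nat xb (c <$> wbar l x)). rw (wmul_bcwbar l x). reflexivity.
  - apply (fm_inj_monic S). rw (inj_wmor_fun x). rw (inj_sunit S' _).
    rw (wbar_Xi_wunit x). rw (inj_sunit S x). reflexivity.
Defined.
End WreathMor.

(* The idempotent of the law [lwdl] before splitting, see [inj_wbar_lwdl]. *)
Definition Theta {C} {a b c : Monad C} (lab : Wdl b a) (lac : Wdl c a) x :
  arr (a (b (c x))) (a (b (c x))) :=
  mu a (b (c x)) ∘ a <$> lab (c x) ∘ a <$> b <$> lac x ∘ a <$> b <$> c <$> eta a x.

(** * Linearity of the idempotent of the law on the left *)

Section LeftTheta.
Context {C : Category} {a b c : Monad C} (lab : Wdl b a) (lac : Wdl c a).

Lemma Theta_mu x : Theta lab lac x ∘ mu a (b (c x)) = mu a (b (c x)) ∘ a <$> Theta lab lac x.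
Proof. unfold Theta. nfr. rw (mu_mu a _). reflexivity. Qed.

Lemma Theta_eta x : Theta lab lac x ∘ eta a (b (c x)) =
  lab (c x) ∘ b <$> lac x ∘ b <$> c <$> eta a x.
Proof. unfold Theta. nfr. rw (mu_eta a _). reflexivity. Qed.

Lemma lab_wbar_Theta x : lab (c x) ∘ b <$> wbar lac x = Theta lab lac x ∘ lab (c x).
Proof. unfold wbar, Theta. norm. rw (law_mus lab (c x)). nf. reflexivity. Qed.

Lemma Theta_wbar x : Theta lab lac x ∘ wbar lab (c x) = Theta lab lac x.
Proof.
  unfold wbar. rw (Theta_mu x). rwl (lab_wbar_Theta x). nfr. rw (wbar_etas lac x).
  unfold Theta. nf. reflexivity.
Qed.

(** The composite [a <$> mu b _ ∘ lab _] is the action of [b] on [a b c]; linearity of [Theta] for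
    it lets [left_mor_mul_rhs] take a product of [b] past [Theta]. *)
Lemma mub_lab_Theta x : a <$> mu b (c x) ∘ lab (b (c x)) ∘ b <$> Theta lab lac x =
  Theta lab lac x ∘ a <$> mu b (c x) ∘ lab (b (c x)).
Proof.
  unfold Theta. norm. rw (law_mus lab _). nfr. rw (law_mut lab (c x)). nf. reflexivity.
Qed.

(** [Theta] passes the product of [a] in [wbar lab] and then the action of [b], and so reaches the
    unit of [a], where [Theta_eta] evaluates it; what results is [Theta] after the product of [b]
    again. *)
Lemma Theta_mub_wbar x : Theta lab lac x ∘ a <$> mu b (c x) ∘ wbar lab (b (c x)) =
  Theta lab lac x ∘ a <$> mu b (c x).
Proof.
  unfold wbar. rwl (mu_nat a (mu b (c x))). rw (Theta_mu x). rwl (mub_lab_Theta x).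
  rw (Theta_eta x). rwl (law_mut lab (c x)). unfold Theta. nf. reflexivity.
Qed.
End LeftTheta.

Section LeftMor.
Context {C D : Category} {c b a : Monad C} {lab : Wdl b a} {lac : Wdl c a}
  {c' b' a' : Monad D} {lab' : Wdl b' a'} {lac' : Wdl c' a'}
  {v : Functor C D} {xc : MndMor c c' v} {xb : MndMor b b' v} {xa : MndMor a a' v}
  (Eab : WdlMor lab lab' xb xa) (Eac : WdlMor lac lac' xc xa).

(** Each of the compatibilities [Eac] and [Eab] leaves an idempotent. The first turns into [Theta]
    on passing [lab], and [Theta] absorbs the second. *)
Lemma Phi_Xi x : v <$> lab (c x) ∘ v <$> b <$> lac x ∘
    xb (c (a x)) ∘ b' <$> xc (a x) ∘ b' <$> c' <$> xa x =
  v <$> Theta lab lac x ∘ xa (b (c x)) ∘ a' <$> xb (c x) ∘ a' <$> b' <$> xc x ∘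
    lab' (c' (v x)) ∘ b' <$> lac' (v x).
Proof.
  rwl (mor_nat xb (lac x)). rw (Eac x). rw (mor_nat xb (wbar lac x)).
  rw (lab_wbar_Theta lab lac x). rw (Eab (c x)).
  rw (Theta_wbar lab lac x). rw (law_nat lab' (xc x)). reflexivity.
Qed.
End LeftMor.

(** * Compatibility of the merged 1-cell with the law on the left *)

Section LeftWreathMor.
Context {C D : Category} {c b a : Monad C} {l : Wdl c b} {lab : Wdl b a} {lac : Wdl c a}
  {c' b' a' : Monad D} {l' : Wdl c' b'} {lab' : Wdl b' a'} {lac' : Wdl c' a'}
  (yb : YangBaxter lab lac l) (yb' : YangBaxter lab' lac' l')
  {v : Functor C D} {xc : MndMor c c' v} {xb : MndMor b b' v} {xa : MndMor a a' v}
  (E : WdlMor l l' xc xb) (Eab : WdlMor lab lab' xb xa) (Eac : WdlMor lac lac' xc xa).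

Lemma al_Theta x : a <$> l x ∘ Theta lac lab x = Theta lab lac x ∘ a <$> l x.
Proof. unfold Theta. nfr. rw (yb x). nfr. reflexivity. Qed.

(** [lhs] and [rhs] are the two sides of the required compatibility before splitting; they are to
    agree after precomposition with the idempotent of [l']. *)
Let lhs x := v <$> lab (c x) ∘ v <$> b <$> lac x ∘ v <$> wbar l (a x) ∘
  xb (c (a x)) ∘ b' <$> xc (a x) ∘ b' <$> c' <$> xa x.
Let rhs x := v <$> Theta lab lac x ∘ v <$> a <$> wbar l x ∘ xa (b (c x)) ∘
  a' <$> xb (c x) ∘ a' <$> b' <$> xc x ∘ lab' (c' (v x)) ∘ b' <$> lac' (v x).

Lemma left_mor_law x : lhs x ∘ l' (a' (v x)) = rhs x ∘ l' (a' (v x)).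
Proof.
  unfold lhs, rhs. norm. rwl (law_nat l' (xa x)). rwl (E (a x)). rw (yb x).
  rw (Phi_Xi Eac Eab x). rw (al_Theta x). rwl (mor_nat xa (l x)). rw (E x).
  rwl (yb' (v x)). rw (mor_nat xa (wbar l x)). reflexivity.
Qed.

Lemma left_mor_mul_lhs x : lhs x ∘ mu b' (c' (a' (v x))) =
  v <$> a <$> mu b (c x) ∘ v <$> lab (b (c x)) ∘ xb (a (b (c x))) ∘ b' <$> lhs x.
Proof.
  unfold lhs. norm. rwl (mu_nat b' (c' <$> xa x)). rwl (mu_nat b' (xc (a x))).
  rw (mor_mu xb (c (a x))). rw (wbar_mus l (a x)). rwl (mu_nat b (lac x)).
  rw (law_mut lab (c x)). nf. reflexivity.
Qed.

(** Taking the action of [b] past [xa] by means of [Eab] costs an idempotent [wbar lab], which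
    [Theta] absorbs by [Theta_mub_wbar]. *)
Lemma left_mor_mul_rhs x : rhs x ∘ mu b' (c' (a' (v x))) =
  v <$> a <$> mu b (c x) ∘ v <$> lab (b (c x)) ∘ xb (a (b (c x))) ∘ b' <$> rhs x.
Proof.
  unfold rhs. norm. rw (mor_nat xb (Theta lab lac x)). rw (mub_lab_Theta lab lac x).
  rw (mor_nat xb (a <$> wbar l x)). rw (law_nat lab (wbar l x)). rw (Eab (b (c x))).
  rwl (wbar_nat lab (wbar l x)).
  rw (Theta_mub_wbar lab lac x).
  rwl (mu_nat b' (lac' (v x))). rw (law_mut lab' _).
  rwl (mu_nat b' (xc x)). rw (mor_mu xb (c x)). nf. rw (wbar_mus l x). nf. reflexivity.
Qed.

Lemma left_mor_wbar x : lhs x ∘ wbar l' (a' (v x)) = rhs x ∘ wbar l' (a' (v x)).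
Proof.
  unfold wbar. rw (left_mor_mul_lhs x). rw (left_mor_law x). rwl (left_mor_mul_rhs x). reflexivity.
Qed.

Context (S : Splitting l) (S' : Splitting l').

Lemma inj_wbar_lwdl x : a <$> inj S x ∘ wbar (lwdl l lab lac yb S) x =
  Theta lab lac x ∘ a <$> inj S x.
Proof.
  unfold wbar, Theta. cbn [wreath mT lwdl law]. nfr.
  rw (inj_lwdl_law l lab lac yb S x). nfr. reflexivity.
Qed.

Lemma lwdl_mor : WdlMor (lwdl l lab lac yb S) (lwdl l' lab' lac' yb' S') (wmor E S S') xa.
Proof.
  intros x. apply (fm_inj_monic2 S). rw (inj_wbar_lwdl x).
  cbn [wreath mT lwdl law wmor mor].
  transitivity (lhs x ∘ inj S' (a' (v x))); [|transitivity (rhs x ∘ inj S' (a' (v x)))].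
  - unfold lhs. norm. rw (inj_lwdl_law l lab lac yb S x).
    rw (inj_wmor_fun S S' (a x)). rw (inj_nat S' (xa x)). reflexivity.
  (* [inj S'] is unchanged by [wbar l'], so equality after precomposition with [wbar l']
     suffices. *)
  - rewrite <- (wbar_inj S' (a' (v x))), <- !cmpA, left_mor_wbar. reflexivity.
  - unfold rhs. norm. rwl (mor_nat xa (inj S x)). rw (inj_wmor_fun S S' x).
    rw (inj_lwdl_law l' lab' lac' yb' S' (v x)). rw (mor_nat xa (wbar l x)). reflexivity.
Qed.
End LeftWreathMor.

(* The idempotent of the law [rwdl] before splitting, see [inj_wbar_rwdl]. *)
Definition Theta' {C} {d c b : Monad C} (lbd : Wdl d b) (lcd : Wdl d c) x :
  arr (b (c (d x))) (b (c (d x))) :=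
  b <$> c <$> mu d x ∘ b <$> lcd (d x) ∘ lbd (c (d x)) ∘ eta d (b (c (d x))).

(** * Linearity of the idempotent of the law on the right *)

Section RightTheta.
Context {C : Category} {d c b : Monad C} (lbd : Wdl d b) (lcd : Wdl d c).

Lemma Theta'_mu x :
  Theta' lbd lcd x ∘ b <$> c <$> mu d x = b <$> c <$> mu d x ∘ Theta' lbd lcd (d x).
Proof. unfold Theta'. nf. rw (mu_mu d _). nf. reflexivity. Qed.

Lemma Theta'_eta x : Theta' lbd lcd x ∘ b <$> c <$> eta d x =
  b <$> lcd x ∘ lbd (c x) ∘ eta d (b (c x)).
Proof. unfold Theta'. nf. rw (mu_Teta d _). reflexivity. Qed.

Lemma lcd_wbar_Theta' x : b <$> lcd x ∘ wbar lbd (c x) = Theta' lbd lcd x ∘ b <$> lcd x.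
Proof. rewrite wbar_alt. unfold Theta'. norm. rw (law_mut lcd x). nf. reflexivity. Qed.

Lemma Theta'_wbar x : Theta' lbd lcd x ∘ b <$> wbar lcd x = Theta' lbd lcd x.
Proof.
  rewrite wbar_alt. norm. rw (Theta'_mu x). rwl (lcd_wbar_Theta' _). rw (wbar_etat lbd _).
  unfold Theta'. nf. reflexivity.
Qed.

Lemma muc_lcd_Theta' x : b <$> mu c (d x) ∘ b <$> c <$> lcd x ∘ Theta' lbd lcd (c x) =
  Theta' lbd lcd x ∘ b <$> mu c (d x) ∘ b <$> c <$> lcd x.
Proof.
  unfold Theta'. norm. rw (law_mut lcd _). nf. rw (law_mus lcd _). nf. reflexivity.
Qed.

Lemma Theta'_muc_wbar x : Theta' lbd lcd x ∘ b <$> mu c (d x) ∘ b <$> c <$> wbar lcd x =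
  Theta' lbd lcd x ∘ b <$> mu c (d x).
Proof.
  rewrite wbar_alt. norm. rw (mu_nat c (mu d x)). rw (Theta'_mu x).
  rwl (muc_lcd_Theta' (d x)). rw (Theta'_eta (c (d x))). unfold Theta'. nf.
  rw (law_mus lcd (d x)). reflexivity.
Qed.
End RightTheta.

Section RightMor.
Context {C D : Category} {d c b : Monad C} {lbd : Wdl d b} {lcd : Wdl d c}
  {d' c' b' : Monad D} {lbd' : Wdl d' b'} {lcd' : Wdl d' c'}
  {v : Functor C D} {xd : MndMor d d' v} {xc : MndMor c c' v} {xb : MndMor b b' v}
  (Ebd : WdlMor lbd lbd' xd xb) (Ecd : WdlMor lcd lcd' xd xc).

Lemma Psi_Xi x : v <$> b <$> lcd x ∘ v <$> lbd (c x) ∘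
    xd (b (c x)) ∘ d' <$> xb (c x) ∘ d' <$> b' <$> xc x =
  v <$> Theta' lbd lcd x ∘ xb (c (d x)) ∘ b' <$> xc (d x) ∘ b' <$> c' <$> xd x ∘
    b' <$> lcd' (v x) ∘ lbd' (c' (v x)).
Proof.
  rw (Ebd (c x)). rw (lcd_wbar_Theta' lbd lcd x). rwl (mor_nat xb (lcd x)).
  rw (law_nat lbd' (xc x)). rw (Ecd x). rw (mor_nat xb (wbar lcd x)).
  rw (Theta'_wbar lbd lcd x). reflexivity.
Qed.
End RightMor.

(** * Compatibility of the merged 1-cell with the law on the right *)

Section RightWreathMor.
Context {C D : Category} {d c b : Monad C} {l : Wdl c b} {lbd : Wdl d b} {lcd : Wdl d c}
  {d' c' b' : Monad D} {l' : Wdl c' b'} {lbd' : Wdl d' b'} {lcd' : Wdl d' c'}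
  (yb : YangBaxter l lbd lcd) (yb' : YangBaxter l' lbd' lcd')
  {v : Functor C D} {xd : MndMor d d' v} {xc : MndMor c c' v} {xb : MndMor b b' v}
  (E : WdlMor l l' xc xb) (Ebd : WdlMor lbd lbd' xd xb) (Ecd : WdlMor lcd lcd' xd xc).

Lemma ld_Theta' x : l (d x) ∘ Theta' lcd lbd x = Theta' lbd lcd x ∘ l (d x).
Proof. unfold Theta'. nf. rwl (yb _). nf. reflexivity. Qed.

Let lhs x := v <$> b <$> lcd x ∘ v <$> lbd (c x) ∘ v <$> d <$> wbar l x ∘
  xd (b (c x)) ∘ d' <$> xb (c x) ∘ d' <$> b' <$> xc x.
Let rhs x := v <$> Theta' lbd lcd x ∘ v <$> wbar l (d x) ∘ xb (c (d x)) ∘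
  b' <$> xc (d x) ∘ b' <$> c' <$> xd x ∘ b' <$> lcd' (v x) ∘ lbd' (c' (v x)).

Lemma right_mor_law x : lhs x ∘ d' <$> l' (v x) = rhs x ∘ d' <$> l' (v x).
Proof.
  unfold lhs, rhs. norm. rwl (mor_nat xd (wbar l x)). rwl (E x). rw (mor_nat xd (l x)).
  rwl (yb x). rw (Psi_Xi Ecd Ebd x). rw (ld_Theta' x). rw (E (d x)).
  rw (law_nat l' (xd x)). rw (yb' (v x)). reflexivity.
Qed.

(** On this side the linearity is over [c'], whose product is the innermost one. Hence [lhs] is
    evaluated at [c x] after an [xc], where the left case applied the functor [b'] to it. *)
Lemma right_mor_mul_lhs x : lhs x ∘ d' <$> b' <$> mu c' (v x) =
  v <$> b <$> mu c (d x) ∘ v <$> b <$> c <$> lcd x ∘ lhs (c x) ∘ d' <$> b' <$> c' <$> xc x.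
Proof.
  unfold lhs. norm. rw (mor_mu xc x). nf. rw (wbar_mut l x). nf. rw (law_mus lcd x).
  nf. reflexivity.
Qed.

Lemma right_mor_mul_rhs x : rhs x ∘ d' <$> b' <$> mu c' (v x) =
  v <$> b <$> mu c (d x) ∘ v <$> b <$> c <$> lcd x ∘ rhs (c x) ∘ d' <$> b' <$> c' <$> xc x.
Proof.
  unfold rhs. norm. rw (muc_lcd_Theta' lbd lcd x). rw (law_nat lbd' (c' <$> xc x)).
  rw (law_nat lcd' (xc x)). rwl (wbar_nat l (lcd x)). rwl (mor_nat xb (c <$> lcd x)).
  rwl (mor_nat xc (lcd x)). rw (Ecd x). rw (mor_nat xc (wbar lcd x)).
  rw (mor_nat xb (c <$> wbar lcd x)). rw (wbar_nat l (wbar lcd x)).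
  rw (Theta'_muc_wbar lbd lcd x).
  rw (law_nat lbd' (mu c' (v x))). rw (law_mus lcd' (v x)). rwl (mu_nat c' (xd x)).
  rw (mor_mu xc (d x)). rw (mor_nat xb (mu c (d x))). rw (wbar_mut l (d x)). nf.
  reflexivity.
Qed.

Lemma right_mor_wbar x : lhs x ∘ d' <$> wbar l' (v x) = rhs x ∘ d' <$> wbar l' (v x).
Proof.
  rewrite wbar_alt. norm. rw (right_mor_mul_lhs x). rwl (law_nat l' (xc x)).
  rw (right_mor_law (c x)). rw (law_nat l' (xc x)). rwl (right_mor_mul_rhs x). reflexivity.
Qed.

Context (S : Splitting l) (S' : Splitting l').

Lemma inj_wbar_rwdl x : inj S (d x) ∘ wbar (rwdl l lbd lcd yb S) x =
  Theta' lbd lcd x ∘ inj S (d x).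
Proof.
  rewrite wbar_alt. unfold Theta'. cbn [wreath mT rwdl law]. nf.
  rw (inj_rwdl_law l lbd lcd yb S (d x)). nf. reflexivity.
Qed.

Lemma rwdl_mor : WdlMor (rwdl l lbd lcd yb S) (rwdl l' lbd' lcd' yb' S') xd (wmor E S S').
Proof.
  intros x. apply (fm_inj_monic S). rw (inj_wbar_rwdl x).
  cbn [wreath mT rwdl law wmor mor].
  transitivity (lhs x ∘ d' <$> inj S' (v x)); [|transitivity (rhs x ∘ d' <$> inj S' (v x))].
  - unfold lhs. norm. rw (inj_rwdl_law l lbd lcd yb S x). rwl (mor_nat xd (inj S x)).
    rw (inj_wmor_fun S S' x). rw (mor_nat xd (wbar l x)). reflexivity.
  - rewrite <- (wbar_inj S' (v x)), !fm_cmp, <- !cmpA, right_mor_wbar. reflexivity.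
  - unfold rhs. norm. rw (inj_wmor_fun S S' (d x)). rw (inj_nat S' (xd x)).
    rw (inj_rwdl_law l' lbd' lcd' yb' S' (v x)). reflexivity.
Qed.
End RightWreathMor.

(** * Naturality in 2-cells and composition of merged 1-cells *)

Section WreathTwoCell.
Context {C D : Category} {c b : Monad C} {l : Wdl c b} {c' b' : Monad D} {l' : Wdl c' b'}
  {v v1 : Functor C D} {xc : MndMor c c' v} {xb : MndMor b b' v}
  {xc1 : MndMor c c' v1} {xb1 : MndMor b b' v1}
  (om : forall x, arr (v x) (v1 x))
  (om_nat : forall x y (f : arr x y), om y ∘ v <$> f = v1 <$> f ∘ om x)
  (omc : forall x, xc1 x ∘ c' <$> om x = om (c x) ∘ xc x)
  (omb : forall x, xb1 x ∘ b' <$> om x = om (b x) ∘ xb x)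
  (S : Splitting l) (S' : Splitting l').

Lemma wmor_fun_om x : wmor_fun (xc := xc1) (xb := xb1) S S' x ∘ S' <$> om x =
  om (S x) ∘ wmor_fun (xc := xc) (xb := xb) S S' x.
Proof.
  unfold wmor_fun. norm. rw (om_nat _ _ (prj S x)). rw (inj_nat S' (om x)). rw (omc x).
  rw (omb (c x)). reflexivity.
Qed.
End WreathTwoCell.

Section WreathMorComp.
Context {B C D : Category} {c b : Monad B} {l : Wdl c b} {c' b' : Monad C} {l' : Wdl c' b'}
  {c'' b'' : Monad D} {v : Functor B C} {w : Functor C D}
  {xc : MndMor c c' v} {xb : MndMor b b' v} (E : WdlMor l l' xc xb)
  (zc : MndMor c' c'' w) (zb : MndMor b' b'' w).

(** The left side is the formula for the composite 1-cell, the right side the composite of the two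
    formulas; [wbar_Xi_wbar] removes the idempotent in between. *)
Lemma wbar_Xi_comp x :
  w <$> v <$> wbar l x ∘ w <$> xb (c x) ∘ zb (v (c x)) ∘ b'' <$> w <$> xc x ∘ b'' <$> zc (v x) =
  w <$> v <$> wbar l x ∘ w <$> xb (c x) ∘ w <$> b' <$> xc x ∘
  w <$> wbar l' (v x) ∘ zb (c' (v x)) ∘ b'' <$> zc (v x).
Proof. rw (wbar_Xi_wbar E x). rw (mor_nat zb (xc x)). reflexivity. Qed.
End WreathMorComp.

(** * Representing the closure of a 2-category on its hom-categories *)

Section TwoCategoryLaws.
Context {K : PreTwoCat} (HK : is_two_category K).

Lemma src_id2 {A B} (f : khom K A B) : ksrc (kid2 f) = f.
Proof. apply HK. Qed.
Lemma tgt_id2 {A B} (f : khom K A B) : ktgt (kid2 f) = f.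
Proof. apply HK. Qed.
Lemma src_v {A B} (a b : kcell K A B) : ktgt b = ksrc a -> ksrc (kvcomp a b) = ksrc b.
Proof. apply HK. Qed.
Lemma tgt_v {A B} (a b : kcell K A B) : ktgt b = ksrc a -> ktgt (kvcomp a b) = ktgt a.
Proof. apply HK. Qed.
Lemma src_h {A B C} (a : kcell K B C) (b : kcell K A B) :
  ksrc (khcomp a b) = kcomp1 (ksrc a) (ksrc b).
Proof. apply HK. Qed.
Lemma tgt_h {A B C} (a : kcell K B C) (b : kcell K A B) :
  ktgt (khcomp a b) = kcomp1 (ktgt a) (ktgt b).
Proof. apply HK. Qed.
Lemma comp1A {A B C D} (f : khom K C D) (g : khom K B C) (h : khom K A B) :
  kcomp1 (kcomp1 f g) h = kcomp1 f (kcomp1 g h).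
Proof. apply HK. Qed.
Lemma comp1l {A B} (f : khom K A B) : kcomp1 (kid1 B) f = f.
Proof. apply HK. Qed.
Lemma comp1r {A B} (f : khom K A B) : kcomp1 f (kid1 A) = f.
Proof. apply HK. Qed.
Lemma vA {A B} (a b c : kcell K A B) : ktgt c = ksrc b -> ktgt b = ksrc a ->
  kvcomp (kvcomp a b) c = kvcomp a (kvcomp b c).
Proof. apply HK. Qed.
Lemma vidl {A B} (a : kcell K A B) : kvcomp (kid2 (ktgt a)) a = a.
Proof. apply HK. Qed.
Lemma hA {A B C D} (a : kcell K C D) (b : kcell K B C) (c : kcell K A B) :
  khcomp (khcomp a b) c = khcomp a (khcomp b c).
Proof. apply HK. Qed.
Lemma hidl {A B} (a : kcell K A B) : khcomp (kid2 (kid1 B)) a = a.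
Proof. apply HK. Qed.
Lemma hidr {A B} (a : kcell K A B) : khcomp a (kid2 (kid1 A)) = a.
Proof. apply HK. Qed.
Lemma interchange {A B C} (a b : kcell K B C) (c d : kcell K A B) :
  ktgt b = ksrc a -> ktgt d = ksrc c ->
  khcomp (kvcomp a b) (kvcomp c d) = kvcomp (khcomp a c) (khcomp b d).
Proof. apply HK. Qed.

(** * Validity of 1-cells and 2-cells of the closure under composition *)

Lemma bok2_src {A B} {f g : bhom K A B} {w} : bok2 K (f, g, w) -> ksrc w = fst f.
Proof. intros H; apply H. Qed.
Lemma bok2_tgt {A B} {f g : bhom K A B} {w} : bok2 K (f, g, w) -> ktgt w = fst g.
Proof. intros H; apply H. Qed.
Lemma bok2_l {A B} {f g : bhom K A B} {w} : bok2 K (f, g, w) -> kvcomp (snd g) w = w.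
Proof. intros H; apply H. Qed.
Lemma bok2_r {A B} {f g : bhom K A B} {w} : bok2 K (f, g, w) -> kvcomp w (snd f) = w.
Proof. intros H; apply H. Qed.

Lemma bok2_id {A B} {f : bhom K A B} : bok1 K f -> bok2 K (f, f, snd f).
Proof. intros (H1 & H2 & H3). repeat split; assumption. Qed.

Lemma bok2_v {A B} {f g h : bhom K A B} {a b} :
  bok2 K (g, h, a) -> bok2 K (f, g, b) -> bok2 K (f, h, kvcomp a b).
Proof.
  intros Ha Hb.
  assert (T : ktgt b = ksrc a) by (rewrite (bok2_src Ha), (bok2_tgt Hb); reflexivity).
  destruct Ha as (Ha0 & (Ha4 & Ha5 & Ha6) & Ha7 & Ha8 & Ha9 & Ha10),
    Hb as ((Hb1 & Hb2 & Hb3) & Hb0 & Hb7 & Hb8 & Hb9 & Hb10).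
  repeat split; try assumption.
  - rewrite (src_v _ _ T). assumption.
  - rewrite (tgt_v _ _ T). assumption.
  - rewrite <- vA; congruence.
  - rewrite vA; congruence.
Qed.

Lemma bok1_comp {A B C} {f : bhom K B C} {g : bhom K A B} :
  bok1 K f -> bok1 K g -> bok1 K (comp1 (C := bar K) f g).
Proof.
  intros (H1 & H2 & H3) (H4 & H5 & H6). repeat split; cbn.
  - rewrite src_h. congruence.
  - rewrite tgt_h. congruence.
  - rewrite <- interchange; congruence.
Qed.

Lemma bok2_h {A B C} {f f' : bhom K B C} {g g' : bhom K A B} {a b} :
  bok2 K (f, f', a) -> bok2 K (g, g', b) ->
  bok2 K (comp1 (C := bar K) f g, comp1 (C := bar K) f' g', khcomp a b).
Proof.
  intros Ha Hb.
  destruct Ha as ((Ha1 & Ha2 & Ha3) & (Ha4 & Ha5 & Ha6) & Ha7 & Ha8 & Ha9 & Ha10),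
    Hb as ((Hb1 & Hb2 & Hb3) & (Hb4 & Hb5 & Hb6) & Hb7 & Hb8 & Hb9 & Hb10).
  refine (conj _ (conj _ _)).
  - apply bok1_comp; repeat split; assumption.
  - apply bok1_comp; repeat split; assumption.
  - cbn. rewrite src_h, tgt_h, <- !interchange; repeat split; congruence.
Qed.

Lemma bcompA {A B C D} (f : bhom K C D) (g : bhom K B C) (h : bhom K A B) :
  comp1 (C := bar K) (comp1 (C := bar K) f g) h = comp1 (C := bar K) f (comp1 (C := bar K) g h).
Proof. cbn. now rewrite comp1A, hA. Qed.
Lemma bcompr {A B} (f : bhom K A B) : comp1 (C := bar K) f (id1 (C := bar K) A) = f.
Proof. destruct f; cbn. now rewrite comp1r, hidr. Qed.
Lemma bcompl {A B} (f : bhom K A B) : comp1 (C := bar K) (id1 (C := bar K) B) f = f.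
Proof. destruct f; cbn. now rewrite comp1l, hidl. Qed.

Lemma bok1_id A : bok1 K (id1 (C := bar K) A).
Proof.
  repeat split; cbn; rewrite ?src_id2, ?tgt_id2; trivial.
  pose proof (vidl (kid2 (kid1 A))) as H. now rewrite tgt_id2 in H.
Qed.

Lemma whisker_r {A B C} (a b : kcell K B C) {f : bhom K A B} : bok1 K f -> ktgt b = ksrc a ->
  khcomp (kvcomp a b) (snd f) = kvcomp (khcomp a (snd f)) (khcomp b (snd f)).
Proof. intros (H1 & H2 & H3) T. rewrite <- interchange; congruence. Qed.

Lemma whisker_l {A B C} (a b : kcell K A B) {f : bhom K B C} : bok1 K f -> ktgt b = ksrc a ->
  khcomp (snd f) (kvcomp a b) = kvcomp (khcomp (snd f) a) (khcomp (snd f) b).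
Proof. intros (H1 & H2 & H3) T. rewrite <- interchange; congruence. Qed.

(** * Hom-categories of the closure and the action of its cells on them *)

Definition homcat (X A : kob K) : Category.
Proof.
  (* Validity is built into subset types, so the category laws hold without side conditions; arrows
     are equal when their underlying 2-cells are, by proof irrelevance. *)
  refine {| obj := {f : bhom K X A | bok1 K f};
    arr f g := {w : kcell K X A | bok2 K (proj1_sig f, proj1_sig g, w)};
    idm f := exist _ (snd (proj1_sig f)) (bok2_id (proj2_sig f));
    cmp f g h a b := exist _ (kvcomp (proj1_sig a) (proj1_sig b))
                       (bok2_v (proj2_sig a) (proj2_sig b)) |}.
  - intros w x y z [f Hf] [g Hg] [h Hh]. apply subset_eq_compat; cbn.
    apply vA; rewrite ?(bok2_src Hf), ?(bok2_tgt Hg), ?(bok2_src Hg), ?(bok2_tgt Hh); trivial.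
  - intros x y [f Hf]. apply subset_eq_compat, (bok2_l Hf).
  - intros x y [f Hf]. apply subset_eq_compat, (bok2_r Hf).
Defined.

Definition postcomp X {A B} (t : bhom K A B) (Ht : bok1 K t) :
  Functor (homcat X A) (homcat X B).
Proof.
  refine {| fob := fun f : homcat X A =>
      exist _ (comp1 (C := bar K) t (proj1_sig f)) (bok1_comp Ht (proj2_sig f)) : homcat X B;
    fm x y a := exist _ (khcomp (snd t) (proj1_sig a)) (bok2_h (bok2_id Ht) (proj2_sig a)) |}.
  - intros x. apply subset_eq_compat; reflexivity.
  - intros x y z [f Hf] [g Hg]. apply subset_eq_compat; cbn.
    destruct Ht as (T1 & T2 & T3). rewrite <- interchange; try congruence.
    now rewrite (bok2_src Hf), (bok2_tgt Hg).
Defined.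

Definition val {X A} {x y : homcat X A} (a : arr x y) : kcell K X A := proj1_sig a.

Lemma val_inj {X A} {x y : homcat X A} (a b : arr x y) : val a = val b -> a = b.
Proof. destruct a, b. apply subset_eq_compat. Qed.

(* The boundary of the whiskered cell is only required up to the associativity of 1-cells,
   so that no transport is needed. *)
Definition cellat {X A B} {f g : bhom K A B} {w} (H : bok2 K (f, g, w)) (x : homcat X A)
  {y z : homcat X B} (Ey : proj1_sig y = comp1 (C := bar K) f (proj1_sig x))
  (Ez : proj1_sig z = comp1 (C := bar K) g (proj1_sig x)) : arr y z.
Proof.
  exists (khcomp w (snd (proj1_sig x))). rewrite Ey, Ez.
  exact (bok2_h H (bok2_id (proj2_sig x))).
Defined.

Lemma cell_nat_l {X A B} {f g : bhom K A B} {w} (H : bok2 K (f, g, w)) {x y : homcat X A}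
  (a : arr x y) :
  kvcomp (khcomp w (snd (proj1_sig y))) (khcomp (snd f) (val a)) = khcomp w (val a).
Proof.
  destruct a as [a Ha]; cbn. destruct x as [x Hx], y as [y Hy]; cbn in *.
  destruct H as ((Ha1 & Ha2 & Ha3) & (Ha4 & Ha5 & Ha6) & Ha7 & Ha8 & Ha9 & Ha10),
    Ha as ((Hb1 & Hb2 & Hb3) & (Hb4 & Hb5 & Hb6) & Hb7 & Hb8 & Hb9 & Hb10).
  rewrite <- !interchange; congruence.
Qed.

Lemma cell_nat {X A B} {f g : bhom K A B} {w} (H : bok2 K (f, g, w)) {x y : homcat X A}
  (a : arr x y) :
  kvcomp (khcomp w (snd (proj1_sig y))) (khcomp (snd f) (val a)) =
  kvcomp (khcomp (snd g) (val a)) (khcomp w (snd (proj1_sig x))).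
Proof.
  destruct a as [a Ha]; cbn. destruct x as [x Hx], y as [y Hy]; cbn in *.
  destruct H as ((Ha1 & Ha2 & Ha3) & (Ha4 & Ha5 & Ha6) & Ha7 & Ha8 & Ha9 & Ha10),
    Ha as ((Hb1 & Hb2 & Hb3) & (Hb4 & Hb5 & Hb6) & Hb7 & Hb8 & Hb9 & Hb10).
  rewrite <- !interchange; congruence.
Qed.

Lemma typ_bok2 {A B} {a : cell (bar K) A B} {f g} : typ a f g -> bok2 K (f, g, snd a).
Proof. destruct a as [[f' g'] w]. now intros (H & <- & <-). Qed.

Lemma bok2_typ {A B} {a : cell (bar K) A B} {f g} :
  bok2 K (f, g, snd a) -> src a = f -> tgt a = g -> typ a f g.
Proof. destruct a as [[f' g'] w]. cbn. now intros H <- <-. Qed.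

Lemma snd_h {A B C} (a : cell (bar K) B C) (b : cell (bar K) A B) :
  snd (hcomp a b) = khcomp (snd a) (snd b).
Proof. now destruct a as [[? ?] ?], b as [[? ?] ?]. Qed.
Lemma barsrc_h {A B C} (a : cell (bar K) B C) (b : cell (bar K) A B) :
  src (hcomp a b) = comp1 (src a) (src b).
Proof. now destruct a as [[? ?] ?], b as [[? ?] ?]. Qed.
Lemma bartgt_h {A B C} (a : cell (bar K) B C) (b : cell (bar K) A B) :
  tgt (hcomp a b) = comp1 (tgt a) (tgt b).
Proof. now destruct a as [[? ?] ?], b as [[? ?] ?]. Qed.
Lemma snd_wl {A B C} (f : hom (bar K) B C) (b : cell (bar K) A B) :
  snd (wl f b) = khcomp (snd f) (snd b).
Proof. apply snd_h. Qed.
Lemma snd_wr {A B C} (b : cell (bar K) B C) (f : hom (bar K) A B) :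
  snd (wr b f) = khcomp (snd b) (snd f).
Proof. apply snd_h. Qed.
Lemma snd_v {A B} (a b : cell (bar K) A B) : snd (vcomp a b) = kvcomp (snd a) (snd b).
Proof. reflexivity. Qed.
Lemma snd_id2 {A B} (f : hom (bar K) A B) : snd (id2 f) = snd f.
Proof. reflexivity. Qed.
Lemma snd_comp1 {A B C} (f : hom (bar K) B C) (g : hom (bar K) A B) :
  snd (comp1 f g) = khcomp (snd f) (snd g).
Proof. reflexivity. Qed.

Lemma bar_ext {A B} (a b : cell (bar K) A B) :
  src a = src b -> tgt a = tgt b -> snd a = snd b -> a = b.
Proof. destruct a as [[? ?] ?], b as [[? ?] ?]; cbn. now intros -> -> ->. Qed.

(** Settles equalities of boundaries by computing sources and targets down to right-bracketed
    composites of 1-cells. *)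
Ltac st := repeat first
  [ rewrite src_h | rewrite tgt_h | rewrite src_v by st | rewrite tgt_v by st
  | match goal with
    | H : bok1 K ?f |- context [ksrc (snd ?f)] => rewrite (proj1 H)
    | H : bok1 K ?f |- context [ktgt (snd ?f)] => rewrite (proj1 (proj2 H))
    | H : bok2 K (_, _, ?w) |- context [ksrc ?w] => rewrite (bok2_src H)
    | H : bok2 K (_, _, ?w) |- context [ktgt ?w] => rewrite (bok2_tgt H)
    end
  | progress cbn [fst snd comp1 id1 bar] | rewrite comp1A | rewrite comp1l | rewrite comp1r ];
  reflexivity.

Ltac sndeq H := apply (f_equal snd) in H;
  rewrite ?snd_v, ?snd_wl, ?snd_wr, ?snd_v, ?snd_id2, ?snd_comp1 in H.
(** Turns an equation between cells of the closure into the equation between components at [x], by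
    whiskering with the identity of [x] and distributing over vertical composites. *)
Ltac whisker H x := sndeq H; apply (f_equal (fun z => khcomp z (snd (proj1_sig x)))) in H;
  rewrite ?(fun a b => whisker_r a b (proj2_sig x)), ?hA in H by st.

Definition hommonad X {A} (m : mon (bar K) A) (Hm : is_monad m) : Monad (homcat X A).
Proof.
  set (Ht := proj1 Hm : bok1 K (mt m)).
  set (Hmu := typ_bok2 (proj1 (proj2 Hm))).
  set (Heta := typ_bok2 (proj1 (proj2 (proj2 Hm)))).
  set (T := postcomp X (mt m) Ht).
  refine {| mT := T;
    mu x := cellat Hmu x (y := T (T x)) (z := T x) (eq_sym (bcompA _ _ _)) eq_refl;
    eta x := cellat Heta x (y := x) (z := T x) (eq_sym (bcompl _)) eq_refl |};
    subst T; pose proof Hm as (_ & _ & _ & H1 & H2 & H3).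
  - intros x y f. apply val_inj. pose proof (cell_nat Hmu f) as H. cbn in H |- *.
    now rewrite hA in H.
  - intros x y f. apply val_inj. pose proof (cell_nat Heta f) as H. cbn in H |- *.
    now rewrite hidl in H.
  - intros x. apply val_inj; cbn. whisker H1 x. exact H1.
  - intros x. apply val_inj; cbn. whisker H3 x. exact H3.
  - intros x. apply val_inj; cbn. whisker H2 x. exact H2.
Defined.

Ltac monad_facts Hm :=
  pose proof (proj1 Hm : bok1 K _);
  pose proof (typ_bok2 (proj1 (proj2 Hm)));
  pose proof (typ_bok2 (proj1 (proj2 (proj2 Hm)))).

Definition homwdl X {A} {t s : mon (bar K) A} (Ht : is_monad t) (Hs : is_monad s) {lam}
  (H : is_wdl (bar K) t s lam) : Wdl (hommonad X t Ht) (hommonad X s Hs).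
Proof.
  set (Hlam := typ_bok2 (proj1 (proj2 (proj2 H)))).
  set (T := hommonad X t Ht). set (S := hommonad X s Hs).
  refine {| law x := cellat Hlam x (y := T (S x)) (z := S (T x))
    (eq_sym (bcompA _ _ _)) (eq_sym (bcompA _ _ _)) |};
    subst T S; pose proof H as (_ & _ & _ & H1 & H2 & H3 & H4); monad_facts Ht; monad_facts Hs;
    intros x.
  - intros y f. apply val_inj. pose proof (cell_nat Hlam f) as E. cbn in E |- *.
    now rewrite !hA in E.
  - apply val_inj; cbn. whisker H1 x. exact H1.
  - apply val_inj; cbn. whisker H2 x. exact H2.
  - apply val_inj; cbn. whisker H3 x. exact H3.
  - apply val_inj; cbn. whisker H4 x. exact H4.
Defined.

Definition hommor X {A A'} {m : mon (bar K) A} {m' : mon (bar K) A'} (Hm : is_monad m)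
  (Hm' : is_monad m') {v : hom (bar K) A A'} (Hv : bok1 K v) {psi} (H : mnd1 (bar K) m m' v psi) :
  MndMor (hommonad X m Hm) (hommonad X m' Hm') (postcomp X v Hv).
Proof.
  set (Hpsi := typ_bok2 (proj1 (proj2 H))).
  set (T := hommonad X m Hm). set (T' := hommonad X m' Hm'). set (V := postcomp X v Hv).
  refine {| mor x := cellat Hpsi x (y := T' (V x)) (z := V (T x))
    (eq_sym (bcompA _ _ _)) (eq_sym (bcompA _ _ _)) |};
    subst T T' V; pose proof H as (_ & _ & H1 & H2); monad_facts Hm; monad_facts Hm';
    intros x.
  - intros y f. apply val_inj. pose proof (cell_nat Hpsi f) as E. cbn in E |- *.
    now rewrite !hA in E.
  - apply val_inj; cbn. whisker H1 x. exact H1.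
  - apply val_inj; cbn. whisker H2 x. exact H2.
Defined.

Lemma homyb X {A} {i j k : mon (bar K) A} (Hi : is_monad i) (Hj : is_monad j) (Hk : is_monad k)
  {lij lik ljk} (Hij : is_wdl (bar K) j i lij) (Hik : is_wdl (bar K) k i lik)
  (Hjk : is_wdl (bar K) k j ljk)
  (E : vcomp (wr lij (mt k)) (vcomp (wl (mt j) lik) (wr ljk (mt i))) =
       vcomp (wl (mt i) ljk) (vcomp (wr lik (mt j)) (wl (mt k) lij))) :
  YangBaxter (homwdl X Hj Hi Hij) (homwdl X Hk Hi Hik) (homwdl X Hk Hj Hjk).
Proof.
  intros x. apply val_inj; cbn.
  monad_facts Hi; monad_facts Hj; monad_facts Hk.
  pose proof (typ_bok2 (proj1 (proj2 (proj2 Hij)))).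
  pose proof (typ_bok2 (proj1 (proj2 (proj2 Hik)))).
  pose proof (typ_bok2 (proj1 (proj2 (proj2 Hjk)))).
  whisker E x. exact E.
Qed.

Lemma val_wbar X {A} {t s : mon (bar K) A} (Ht : is_monad t) (Hs : is_monad s) {lam}
  (H : is_wdl (bar K) t s lam) x :
  val (wbar (homwdl X Ht Hs H) x) = khcomp (snd (lambar t s lam)) (snd (proj1_sig x)).
Proof.
  unfold lambar. rewrite !snd_v, !snd_wr, !snd_wl, !snd_comp1.
  monad_facts Ht; monad_facts Hs. pose proof (typ_bok2 (proj1 (proj2 (proj2 H)))).
  rewrite !(fun a b => whisker_r a b (proj2_sig x)), !hA by st. reflexivity.
Qed.

Definition homid A : homcat A A := exist _ (id1 (C := bar K) A) (bok1_id A).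

Lemma arr_bok2 {X A} {y z : homcat X A} (a : arr y z) {f g w} :
  proj1_sig y = f -> proj1_sig z = g -> val a = w -> bok2 K (f, g, w).
Proof. intros <- <- <-. exact (proj2_sig a). Qed.

(** All validity conditions are read off from the arrow [wbar] at the identity 1-cell, whose type
    already contains them. *)
Lemma bok2_lambar {A} {t s : mon (bar K) A} (Ht : is_monad t) (Hs : is_monad s) {lam}
  (H : is_wdl (bar K) t s lam) :
  bok2 K (comp1 (mt s) (mt t), comp1 (mt s) (mt t), snd (lambar t s lam)).
Proof.
  refine (arr_bok2 (wbar (homwdl A Ht Hs H) (homid A)) _ _ _).
  - exact (f_equal (comp1 (C := bar K) (mt s)) (bcompr (mt t))).
  - exact (f_equal (comp1 (C := bar K) (mt s)) (bcompr (mt t))).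
  - rewrite val_wbar. apply hidr.
Qed.

Lemma homwdlmor X {A A'} {t s : mon (bar K) A} {t' s' : mon (bar K) A'}
  (Ht : is_monad t) (Hs : is_monad s) (Ht' : is_monad t') (Hs' : is_monad s') {lam lam'}
  (Hl : is_wdl (bar K) t s lam) (Hl' : is_wdl (bar K) t' s' lam')
  {v : hom (bar K) A A'} (Hv : bok1 K v) {xi zeta}
  (Hxi : mnd1 (bar K) t t' v xi) (Hzeta : mnd1 (bar K) s s' v zeta)
  (E : wdl1 (bar K) t s lam t' s' lam' v xi zeta) :
  WdlMor (homwdl X Ht Hs Hl) (homwdl X Ht' Hs' Hl') (hommor X Ht Ht' Hv Hxi)
    (hommor X Hs Hs' Hv Hzeta).
Proof.
  intros x. apply val_inj.
  change (val (?f ∘ ?g)) with (kvcomp (val f) (val g)).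
  change (val (postcomp X v Hv <$> ?f)) with (khcomp (snd v) (val f)).
  rewrite val_wbar. cbn.
  destruct E as (_ & _ & E). monad_facts Ht; monad_facts Hs; monad_facts Ht'; monad_facts Hs'.
  pose proof (typ_bok2 (proj1 (proj2 (proj2 Hl)))).
  pose proof (typ_bok2 (proj1 (proj2 (proj2 Hl')))).
  pose proof (typ_bok2 (proj1 (proj2 Hxi))).
  pose proof (typ_bok2 (proj1 (proj2 Hzeta))).
  pose proof (bok2_lambar Ht Hs Hl).
  whisker E x. exact E.
Qed.

(** * The induced monad splits the idempotent in the closure *)

Section WeakWreath.
Context {A : kob K} {t s : mon (bar K) A} (Ht : is_monad t) (Hs : is_monad s)
  {lam : cell (bar K) A A} (H : is_wdl (bar K) t s lam).

Lemma lambar_idem :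
  kvcomp (snd (lambar t s lam)) (snd (lambar t s lam)) = snd (lambar t s lam).
Proof.
  pose proof (f_equal val (wbar_idem (homwdl A Ht Hs H) (homid A))) as E.
  change (val (?f ∘ ?g)) with (kvcomp (val f) (val g)) in E.
  rewrite val_wbar in E. cbn [homid proj1_sig id1 bar snd] in E. now rewrite hidr in E.
Qed.

Lemma bok1_wwp_hom : bok1 K (wwp_hom K s t lam).
Proof.
  pose proof (bok2_lambar Ht Hs H) as B. refine (conj _ (conj _ lambar_idem)).
  - exact (bok2_src B).
  - exact (bok2_tgt B).
Qed.

(** In the closure an idempotent splits through itself: the same 2-cell, with different boundaries,
    is the inclusion here and the projection in [bok2_prj]. *)
Lemma bok2_inj : bok2 K (wwp_hom K s t lam, comp1 (mt s) (mt t), snd (lambar t s lam)).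
Proof.
  pose proof (bok2_lambar Ht Hs H) as B. pose proof bok1_wwp_hom as B'.
  exact (conj B' (conj (proj1 B) (conj (bok2_src B) (conj (bok2_tgt B)
    (conj (bok2_l B) lambar_idem))))).
Qed.
Lemma bok2_prj : bok2 K (comp1 (mt s) (mt t), wwp_hom K s t lam, snd (lambar t s lam)).
Proof.
  pose proof (bok2_lambar Ht Hs H) as B. pose proof bok1_wwp_hom as B'.
  exact (conj (proj1 B) (conj B' (conj (bok2_src B) (conj (bok2_tgt B)
    (conj lambar_idem (bok2_r B)))))).
Qed.

Definition homsplit X : Splitting (homwdl X Ht Hs H).
Proof.
  set (T := hommonad X t Ht). set (S := hommonad X s Hs).
  set (M := postcomp X (wwp_hom K s t lam) bok1_wwp_hom).
  refine {| sM := M;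
    inj x := cellat bok2_inj x (y := M x) (z := S (T x)) eq_refl (eq_sym (bcompA _ _ _));
    prj x := cellat bok2_prj x (y := S (T x)) (z := M x) (eq_sym (bcompA _ _ _)) eq_refl |};
    subst T S M; intros x.
  - intros y f. apply val_inj. pose proof (cell_nat bok2_inj f) as E.
    rewrite snd_comp1, !hA in E. exact E.
  - intros y f. apply val_inj. pose proof (cell_nat bok2_prj f) as E.
    rewrite snd_comp1, !hA in E. exact E.
  - apply val_inj. exact (proj2 (proj2 (bok1_comp bok1_wwp_hom (proj2_sig x)))).
  - apply val_inj. rewrite val_wbar.
    exact (proj2 (proj2 (bok1_comp bok1_wwp_hom (proj2_sig x)))).
Defined.

(** The horizontal composite of multiplications in [wwp] becomes a vertical composite of whiskered
    ones by interchange, in the form of [cell_nat_l]. *)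
Lemma val_wmul X x : val (wmul (homwdl X Ht Hs H) x) =
  khcomp (snd (mmu (wwp K s t lam))) (snd (proj1_sig x)).
Proof.
  cbn [wwp mmu retype snd]. rewrite snd_v, snd_h, snd_wl, snd_wr.
  monad_facts Ht; monad_facts Hs. pose proof (typ_bok2 (proj1 (proj2 (proj2 H)))).
  rewrite !(fun a b => whisker_r a b (proj2_sig x)), !hA by st.
  pose proof (cell_nat_l (typ_bok2 (proj1 (proj2 Hs))) (mu (hommonad X t Ht) x)) as E.
  cbn in E. rewrite hA in E. rewrite <- E.
  pose proof (proj2_sig x : bok1 K (proj1_sig x)). rewrite vA by st. reflexivity.
Qed.

Lemma val_wunit X x : val (wunit (homwdl X Ht Hs H) x) =
  khcomp (snd (meta (wwp K s t lam))) (snd (proj1_sig x)).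
Proof.
  cbn [wwp meta retype snd]. rewrite snd_v, snd_h.
  monad_facts Ht; monad_facts Hs. pose proof (typ_bok2 (proj1 (proj2 (proj2 H)))).
  rewrite !(fun a b => whisker_r a b (proj2_sig x)), !hA by st.
  pose proof (cell_nat_l (typ_bok2 (proj1 (proj2 (proj2 Ht)))) (eta (hommonad X s Hs) x)) as E.
  cbn in E. rewrite hidl in E. rewrite <- E. reflexivity.
Qed.

(** The underlying 2-cell of [inj] is the identity of the split object and is absorbed by every
    2-cell into that object. Underlying 2-cells may therefore be computed after [inj]. *)
Lemma val_postcomp_inj X {B} {v : hom (bar K) A B} (Hv : bok1 K v) {x y}
  (f : arr x (postcomp X v Hv (homsplit X y))) :
  val (postcomp X v Hv <$> inj (homsplit X) y ∘ f) = val f.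
Proof. exact (bok2_l (proj2_sig f)). Qed.

Lemma val_split_inj X {x y} (f : arr x (homsplit X y)) : val (inj (homsplit X) y ∘ f) = val f.
Proof. exact (bok2_l (proj2_sig f)). Qed.

(** [inj] and [wbar] have the same underlying 2-cell but different boundaries, so the comparison is
    made after [val]; interchange reduces both sides to one horizontal composite. *)
Lemma val_inj_inj X x :
  val (hommonad X s Hs <$> hommonad X t Ht <$> inj (homsplit X) x ∘
    inj (homsplit X) (homsplit X x)) =
  val (hommonad X s Hs <$> hommonad X t Ht <$> wbar (homwdl X Ht Hs H) x ∘
    wbar (homwdl X Ht Hs H) (hommonad X s Hs (hommonad X t Ht x))).
Proof.
  pose proof (cell_nat bok2_inj (inj (homsplit X) x)) as E1.
  pose proof (cell_nat_l bok2_inj (inj (homsplit X) x)) as E2.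
  pose proof (cell_nat (bok2_lambar Ht Hs H) (wbar (homwdl X Ht Hs H) x)) as E3.
  pose proof (cell_nat_l (bok2_lambar Ht Hs H) (wbar (homwdl X Ht Hs H) x)) as E4.
  rewrite snd_comp1, !hA in E1, E3, E4.
  change (val (?f ∘ ?g)) with (kvcomp (val f) (val g)). rewrite val_wbar.
  etransitivity; [exact (eq_trans (eq_sym E1) E2)|].
  etransitivity; [|exact (eq_trans (eq_sym E4) E3)].
  rewrite val_wbar. reflexivity.
Qed.

(** After [inj], [smul] is [wmul] preceded by two inclusions; their 2-cells are idempotents that
    [wmul] absorbs at its inputs. *)
Lemma val_smul X x : val (smul (homsplit X) x) =
  khcomp (snd (mmu (wwp K s t lam))) (snd (proj1_sig x)).
Proof.
  rewrite <- val_split_inj, inj_smul, <- val_wmul.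
  rewrite <- (wmul_wbar (homwdl X Ht Hs H) x) at 2.
  rewrite <- (wmul_bcwbar (homwdl X Ht Hs H) x) at 2. rewrite cmpA.
  exact (f_equal (kvcomp _) (val_inj_inj X x)).
Qed.

Lemma val_sunit X x : val (sunit (homsplit X) x) =
  khcomp (snd (meta (wwp K s t lam))) (snd (proj1_sig x)).
Proof. rewrite <- val_split_inj, inj_sunit, <- val_wunit. reflexivity. Qed.
End WeakWreath.

(** * Recovering monads, laws and 1-cells of the closure from their action at the identity *)

Ltac bst := unfold wl, wr; repeat first
  [ rewrite barsrc_h | rewrite bartgt_h
  | match goal with
    | H : typ ?a _ _ |- context [src ?a] => rewrite (proj1 (proj2 H))
    | H : typ ?a _ _ |- context [tgt ?a] => rewrite (proj2 (proj2 H))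
    end
  | progress change (src (vcomp ?a ?b)) with (src b)
  | progress change (tgt (vcomp ?a ?b)) with (tgt a)
  | progress change (src (id2 ?f)) with f
  | progress change (src (retype ?a ?f ?g)) with f
  | progress change (tgt (retype ?a ?f ?g)) with g
  | progress change (tgt (id2 ?f)) with f
  | rewrite bcompA | rewrite bcompl | rewrite bcompr ]; reflexivity.
Lemma val_cmp {X A} {x y z : homcat X A} (f : arr y z) (g : arr x y) :
  val (f ∘ g) = kvcomp (val f) (val g).
Proof. reflexivity. Qed.
Lemma val_idm {X A} (x : homcat X A) : val (idm x) = snd (proj1_sig x).
Proof. reflexivity. Qed.
Lemma val_fm X {A B} (v : hom (bar K) A B) Hv {x y} (f : arr x y) :
  val (postcomp X v Hv <$> f) = khcomp (snd v) (val f).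
Proof. reflexivity. Qed.
Lemma val_fmT X {A} (m : mon (bar K) A) Hm {x y} (f : arr x y) :
  val (hommonad X m Hm <$> f) = khcomp (snd (mt m)) (val f).
Proof. reflexivity. Qed.
Lemma val_mu X {A} (m : mon (bar K) A) Hm x :
  val (mu (hommonad X m Hm) x) = khcomp (snd (mmu m)) (snd (proj1_sig x)).
Proof. reflexivity. Qed.
Lemma val_eta X {A} (m : mon (bar K) A) Hm x :
  val (eta (hommonad X m Hm) x) = khcomp (snd (meta m)) (snd (proj1_sig x)).
Proof. reflexivity. Qed.
Lemma snd_fob X {A B} (v : hom (bar K) A B) Hv x :
  snd (proj1_sig (postcomp X v Hv x)) = khcomp (snd v) (snd (proj1_sig x)).
Proof. reflexivity. Qed.
Lemma snd_fobT X {A} (m : mon (bar K) A) Hm x :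
  snd (proj1_sig (hommonad X m Hm x)) = khcomp (snd (mt m)) (snd (proj1_sig x)).
Proof. reflexivity. Qed.
Lemma snd_homid A : snd (proj1_sig (homid A)) = kid2 (kid1 A).
Proof. reflexivity. Qed.
Ltac vsimp E := apply (f_equal val) in E;
  repeat first [rewrite val_cmp in E | rewrite val_fmT in E | rewrite val_fm in E
    | rewrite val_mu in E | rewrite val_eta in E | rewrite val_idm in E
    | match goal with H : forall x, val _ = _ |- _ => rewrite H in E end
    | rewrite snd_fobT in E | rewrite snd_fob in E | rewrite snd_homid in E | rewrite hidr in E ].
Ltac to_val E := apply bar_ext; [bst|bst|];
  repeat first [rewrite snd_v | rewrite snd_wl | rewrite snd_wr | rewrite snd_id2
    | rewrite snd_comp1 | rewrite hA]; exact E.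

(** [W] is any monad with the right functor and components: it will be a [wreath], which can be
    identified with a [hommonad] only once the conclusion is known. *)
Lemma is_monad_of_hommonad {A} (m : mon (bar K) A) (Ht : bok1 K (mt m)) (W : Monad (homcat A A))
  (HT : mT W = postcomp A (mt m) Ht)
  (Hmu : forall x, val (mu W x) = khcomp (snd (mmu m)) (snd (proj1_sig x)))
  (Heta : forall x, val (eta W x) = khcomp (snd (meta m)) (snd (proj1_sig x))) :
  src (mmu m) = comp1 (mt m) (mt m) -> tgt (mmu m) = mt m ->
  src (meta m) = id1 (C := bar K) A -> tgt (meta m) = mt m -> is_monad m.
Proof.
  destruct W as [T m0 e0 ? ? E1 E2 E3]; cbn [mT mu eta] in *.
  subst T. intros S1 T1 S2 T2.
  assert (typ (mmu m) (comp1 (mt m) (mt m)) (mt m)).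
  { apply bok2_typ; trivial. refine (arr_bok2 (m0 (homid A)) _ _ _).
    - exact (f_equal (comp1 (C := bar K) (mt m)) (bcompr (mt m))).
    - exact (bcompr (mt m)).
    - rewrite Hmu. apply hidr. }
  assert (typ (meta m) (id1 (C := bar K) A) (mt m)).
  { apply bok2_typ; trivial. refine (arr_bok2 (e0 (homid A)) _ _ _).
    - reflexivity.
    - exact (bcompr (mt m)).
    - rewrite Heta. apply hidr. }
  specialize (E1 (homid A)). specialize (E2 (homid A)). specialize (E3 (homid A)).
  refine (conj Ht (conj _ (conj _ (conj _ (conj _ _))))); trivial.
  - vsimp E1. to_val E1.
  - vsimp E3. to_val E3.
  - vsimp E2. to_val E2.
Qed.

Lemma is_monad_wwp {A} {t s : mon (bar K) A} (Ht : is_monad t) (Hs : is_monad s) {lam}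
  (H : is_wdl (bar K) t s lam) : is_monad (wwp K s t lam).
Proof.
  refine (is_monad_of_hommonad (wwp K s t lam) (bok1_wwp_hom Ht Hs H)
    (wreath (homsplit Ht Hs H A)) eq_refl _ _ eq_refl eq_refl eq_refl eq_refl).
  - apply val_smul.
  - apply val_sunit.
Qed.

Lemma Monad_ext {C} (W W' : Monad C) (E : mT W = mT W') :
  (forall x, match E in _ = T return arr (T (T x)) (T x) with eq_refl => mu W x end = mu W' x) ->
  (forall x, match E in _ = T return arr x (T x) with eq_refl => eta W x end = eta W' x) ->
  W = W'.
Proof.
  destruct W as [T m0 e0 ? ? ? ? ?], W' as [T' m1 e1 ? ? ? ? ?]; cbn in E; destruct E; cbn.
  intros E1 E2. apply functional_extensionality_dep in E1, E2. subst.
  f_equal; apply proof_irrelevance.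
Qed.

Lemma hommonad_ext X {A} (m : mon (bar K) A) (Hm : is_monad m) Ht (W : Monad (homcat X A))
  (HT : mT W = postcomp X (mt m) Ht)
  (Hmu : forall x, val (mu W x) = khcomp (snd (mmu m)) (snd (proj1_sig x)))
  (Heta : forall x, val (eta W x) = khcomp (snd (meta m)) (snd (proj1_sig x))) :
  W = hommonad X m Hm.
Proof.
  destruct W as [T m0 e0 ? ? ? ? ?]; cbn [mT mu eta] in *. subst T.
  (* Identifying the two proofs that [mt m] is valid makes the two functors the same term, so no
     transport is left. *)
  pose proof (proof_irrelevance _ Ht (proj1 Hm)) as E. subst Ht.
  match goal with |- ?W = _ => refine (Monad_ext W (hommonad X m Hm) eq_refl _ _) end.
  - intros x. apply val_inj, Hmu.
  - intros x. apply val_inj, Heta.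
Qed.

(** The functors agree by computation and the components have equal underlying 2-cells. The
    identification allows laws and 1-cells built on [wreath] to be read back in the closure. *)
Lemma wreath_homsplit X {A} {t s : mon (bar K) A} (Ht : is_monad t) (Hs : is_monad s) {lam}
  (H : is_wdl (bar K) t s lam) (Hw : is_monad (wwp K s t lam)) :
  wreath (homsplit Ht Hs H X) = hommonad X (wwp K s t lam) Hw.
Proof.
  refine (hommonad_ext X (wwp K s t lam) Hw (bok1_wwp_hom Ht Hs H)
    (wreath (homsplit Ht Hs H X)) eq_refl _ _).
  - apply val_smul.
  - apply val_sunit.
Qed.

(** [T] and [S] are variables with equations [ET] and [ES], so that either may be a [wreath]; [HL]
    compares underlying 2-cells only and thus involves no transport. *)
Lemma is_wdl_of_homwdl {A} {t s : mon (bar K) A} (Ht : is_monad t) (Hs : is_monad s)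
  {lam : cell (bar K) A A}
  {T S : Monad (homcat A A)} (L : Wdl T S) (ET : T = hommonad A t Ht) (ES : S = hommonad A s Hs)
  (HL : forall x, val (L x) = khcomp (snd lam) (snd (proj1_sig x))) :
  src lam = comp1 (mt t) (mt s) -> tgt lam = comp1 (mt s) (mt t) -> is_wdl (bar K) t s lam.
Proof.
  subst T S. intros S1 T1.
  assert (typ lam (comp1 (mt t) (mt s)) (comp1 (mt s) (mt t))).
  { apply bok2_typ; trivial. refine (arr_bok2 (L (homid A)) _ _ _).
    - exact (f_equal (comp1 (C := bar K) (mt t)) (bcompr (mt s))).
    - exact (f_equal (comp1 (C := bar K) (mt s)) (bcompr (mt t))).
    - rewrite HL. apply hidr. }
  pose proof (law_mut L (homid A)) as E1. pose proof (law_mus L (homid A)) as E2.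
  pose proof (law_etat L (homid A)) as E3. pose proof (law_etas L (homid A)) as E4.
  pose proof Ht as (_ & ? & ? & _). pose proof Hs as (_ & ? & ? & _).
  refine (conj Ht (conj Hs (conj _ (conj _ (conj _ (conj _ _)))))); trivial.
  - vsimp E1. to_val E1.
  - vsimp E2. to_val E2.
  - vsimp E3. to_val E3.
  - vsimp E4. to_val E4.
Qed.

Lemma yb_of_homyb {A} {i j k : mon (bar K) A} {Hi : is_monad i} {Hj : is_monad j}
  {Hk : is_monad k} {lij lik ljk} (Hij : is_wdl (bar K) j i lij) (Hik : is_wdl (bar K) k i lik)
  (Hjk : is_wdl (bar K) k j ljk) {I J M : Monad (homcat A A)}
  (EI : I = hommonad A i Hi) (EJ : J = hommonad A j Hj) (EM : M = hommonad A k Hk)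
  {Lij : Wdl J I} {Lik : Wdl M I} {Ljk : Wdl M J}
  (Vij : forall x, val (Lij x) = khcomp (snd lij) (snd (proj1_sig x)))
  (Vik : forall x, val (Lik x) = khcomp (snd lik) (snd (proj1_sig x)))
  (Vjk : forall x, val (Ljk x) = khcomp (snd ljk) (snd (proj1_sig x)))
  (Y : YangBaxter Lij Lik Ljk) :
  vcomp (wr lij (mt k)) (vcomp (wl (mt j) lik) (wr ljk (mt i))) =
  vcomp (wl (mt i) ljk) (vcomp (wr lik (mt j)) (wl (mt k) lij)).
Proof.
  subst I J M. pose proof Hij as (_ & _ & ? & _). pose proof Hik as (_ & _ & ? & _).
  pose proof Hjk as (_ & _ & ? & _). pose proof (Y (homid A)) as E. vsimp E. to_val E.
Qed.

Lemma mnd1_of_hommor {A A'} {m : mon (bar K) A} {m' : mon (bar K) A'} (Hm : is_monad m)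
  (Hm' : is_monad m') {v : hom (bar K) A A'} (Hv : bok1 K v) {psi : cell (bar K) A A'}
  {T : Monad (homcat A A)} {T' : Monad (homcat A A')}
  (ET : T = hommonad A m Hm) (ET' : T' = hommonad A m' Hm')
  (P : MndMor T T' (postcomp A v Hv))
  (HP : forall x, val (P x) = khcomp (snd psi) (snd (proj1_sig x))) :
  src psi = comp1 (mt m') v -> tgt psi = comp1 v (mt m) -> mnd1 (bar K) m m' v psi.
Proof.
  subst T T'. intros S1 T1.
  assert (typ psi (comp1 (mt m') v) (comp1 v (mt m))).
  { apply bok2_typ; trivial. refine (arr_bok2 (P (homid A)) _ _ _).
    - exact (f_equal (comp1 (C := bar K) (mt m')) (bcompr v)).
    - exact (f_equal (comp1 (C := bar K) v) (bcompr (mt m))).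
    - rewrite HP. apply hidr. }
  pose proof (mor_mu P (homid A)) as E1. pose proof (mor_eta P (homid A)) as E2.
  pose proof Hm as (_ & ? & ? & _). pose proof Hm' as (_ & ? & ? & _).
  refine (conj Hv (conj _ (conj _ _))); trivial.
  - vsimp E1. to_val E1.
  - vsimp E2. to_val E2.
Qed.

Lemma wdl1_of_homwdlmor {A A'} {t s : mon (bar K) A} {t' s' : mon (bar K) A'}
  {Ht : is_monad t} {Hs : is_monad s} {Ht' : is_monad t'} {Hs' : is_monad s'} {lam lam'}
  (Hl : is_wdl (bar K) t s lam) (Hl' : is_wdl (bar K) t' s' lam')
  {v : hom (bar K) A A'} {Hv : bok1 K v} {xi zeta}
  (Hxi : mnd1 (bar K) t t' v xi) (Hzeta : mnd1 (bar K) s s' v zeta)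
  {T S : Monad (homcat A A)} {T' S' : Monad (homcat A A')}
  (ET : T = hommonad A t Ht) (ES : S = hommonad A s Hs)
  (ET' : T' = hommonad A t' Ht') (ES' : S' = hommonad A s' Hs')
  {L : Wdl T S} {L' : Wdl T' S'} {x : MndMor T T' (postcomp A v Hv)}
  {z : MndMor S S' (postcomp A v Hv)}
  (VL : forall y, val (L y) = khcomp (snd lam) (snd (proj1_sig y)))
  (VL' : forall y, val (L' y) = khcomp (snd lam') (snd (proj1_sig y)))
  (Vx : forall y, val (x y) = khcomp (snd xi) (snd (proj1_sig y)))
  (Vz : forall y, val (z y) = khcomp (snd zeta) (snd (proj1_sig y)))
  (E : WdlMor L L' x z) : wdl1 (bar K) t s lam t' s' lam' v xi zeta.
Proof.
  subst T S T' S'. refine (conj Hxi (conj Hzeta _)).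
  pose proof Hl as (_ & _ & ? & _). pose proof Hl' as (_ & _ & ? & _).
  pose proof Hxi as (_ & ? & _). pose proof Hzeta as (_ & ? & _).
  pose proof Ht as (_ & ? & ? & _). pose proof Hs as (_ & ? & ? & _).
  specialize (E (homid A)). unfold wbar in E. vsimp E. unfold lambar. to_val E.
Qed.

(** * The new laws in the closure and the relations between them *)

Ltac wdl_facts H := pose proof (typ_bok2 (proj1 (proj2 (proj2 H)))).

Definition bar_yb {A} (i j k : mon (bar K) A) (lij lik ljk : cell (bar K) A A) : Prop :=
  vcomp (wr lij (mt k)) (vcomp (wl (mt j) lik) (wr ljk (mt i))) =
  vcomp (wl (mt i) ljk) (vcomp (wr lik (mt j)) (wl (mt k) lij)).

(** Here and in [rightlaw] and [wreathmor], the formulas of [Ck_lam] and [Ck1] with named monads in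
    place of indices; [b] and [c] are the pair to be merged. *)
Definition leftlaw {A} (a b c : mon (bar K) A) (lab lac l : cell (bar K) A A) :=
  let M := wwp_hom K b c l in
  retype (vcomp (wr lab (mt c)) (vcomp (wl (mt b) lac) (wr (lambar c b l) (mt a))))
    (comp1 M (mt a)) (comp1 (mt a) M).

Definition rightlaw {A} (b c d : mon (bar K) A) (lbd lcd l : cell (bar K) A A) :=
  let M := wwp_hom K b c l in
  retype (vcomp (wl (mt b) lcd) (vcomp (wr lbd (mt c)) (wl (mt d) (lambar c b l))))
    (comp1 (mt d) M) (comp1 M (mt d)).

Definition wreathmor {A A'} (b c : mon (bar K) A) (b' c' : mon (bar K) A')
  (l : cell (bar K) A A) (l' : cell (bar K) A' A') (v : hom (bar K) A A')
  (xb xc : cell (bar K) A A') :=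
  retype (vcomp (wl v (lambar c b l)) (vcomp (wr xb (mt c)) (wl (mt b') xc)))
    (comp1 (wwp_hom K b' c' l') v) (comp1 v (wwp_hom K b c l)).

Section Left.
Context {A : kob K} {a b c : mon (bar K) A} (Ha : is_monad a) (Hb : is_monad b)
  (Hc : is_monad c) {lab lac l : cell (bar K) A A} (Hab : is_wdl (bar K) b a lab)
  (Hac : is_wdl (bar K) c a lac) (Hl : is_wdl (bar K) c b l)
  (Y : bar_yb a b c lab lac l).

Definition homleft X : Wdl (wreath (homsplit Hc Hb Hl X)) (hommonad X a Ha) :=
  lwdl (homwdl X Hc Hb Hl) (homwdl X Hb Ha Hab) (homwdl X Hc Ha Hac)
    (homyb X Ha Hb Hc Hab Hac Hl Y) (homsplit Hc Hb Hl X).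

Lemma val_homleft X x :
  val (homleft X x) = khcomp (snd (leftlaw a b c lab lac l)) (snd (proj1_sig x)).
Proof.
  etransitivity; [exact (eq_sym (val_postcomp_inj Hc Hb Hl X (proj1 Ha) (homleft X x)))|].
  etransitivity; [exact (f_equal val (inj_lwdl_law (homwdl X Hc Hb Hl) (homwdl X Hb Ha Hab)
    (homwdl X Hc Ha Hac) (homyb X Ha Hb Hc Hab Hac Hl Y) (homsplit Hc Hb Hl X) x))|].
  unfold leftlaw, retype. cbn [snd]. rewrite !snd_v, !snd_wl, !snd_wr.
  monad_facts Ha; monad_facts Hb; monad_facts Hc; wdl_facts Hab; wdl_facts Hac; wdl_facts Hl.
  pose proof (bok2_lambar Hc Hb Hl).
  rewrite !(fun a b => whisker_r a b (proj2_sig x)), !hA by st. reflexivity.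
Qed.

Lemma is_wdl_left : is_wdl (bar K) (wwp K b c l) a (leftlaw a b c lab lac l).
Proof.
  exact (is_wdl_of_homwdl (is_monad_wwp Hc Hb Hl) Ha (homleft A)
    (wreath_homsplit A Hc Hb Hl (is_monad_wwp Hc Hb Hl)) eq_refl (val_homleft A)
    eq_refl eq_refl).
Qed.
End Left.

Section Right.
Context {A : kob K} {b c d : mon (bar K) A} (Hb : is_monad b)
  (Hc : is_monad c) (Hd : is_monad d) {lbd lcd l : cell (bar K) A A}
  (Hbd : is_wdl (bar K) d b lbd) (Hcd : is_wdl (bar K) d c lcd) (Hl : is_wdl (bar K) c b l)
  (Y : bar_yb b c d l lbd lcd).

Definition homright X : Wdl (hommonad X d Hd) (wreath (homsplit Hc Hb Hl X)) :=
  rwdl (homwdl X Hc Hb Hl) (homwdl X Hd Hb Hbd) (homwdl X Hd Hc Hcd)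
    (homyb X Hb Hc Hd Hl Hbd Hcd Y) (homsplit Hc Hb Hl X).

Lemma val_homright X x :
  val (homright X x) = khcomp (snd (rightlaw b c d lbd lcd l)) (snd (proj1_sig x)).
Proof.
  etransitivity; [exact (eq_sym (val_split_inj Hc Hb Hl X (homright X x)))|].
  etransitivity; [exact (f_equal val (inj_rwdl_law (homwdl X Hc Hb Hl) (homwdl X Hd Hb Hbd)
    (homwdl X Hd Hc Hcd) (homyb X Hb Hc Hd Hl Hbd Hcd Y) (homsplit Hc Hb Hl X) x))|].
  unfold rightlaw, retype. cbn [snd]. rewrite !snd_v, !snd_wl, !snd_wr.
  monad_facts Hd; monad_facts Hb; monad_facts Hc; wdl_facts Hbd; wdl_facts Hcd; wdl_facts Hl.
  pose proof (bok2_lambar Hc Hb Hl).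
  rewrite !(fun a b => whisker_r a b (proj2_sig x)), !hA by st. reflexivity.
Qed.

Lemma is_wdl_right : is_wdl (bar K) d (wwp K b c l) (rightlaw b c d lbd lcd l).
Proof.
  exact (is_wdl_of_homwdl Hd (is_monad_wwp Hc Hb Hl) (homright A) eq_refl
    (wreath_homsplit A Hc Hb Hl (is_monad_wwp Hc Hb Hl)) (val_homright A) eq_refl eq_refl).
Qed.
End Right.

Lemma val_homwdl X {A} {t s : mon (bar K) A} (Ht : is_monad t) (Hs : is_monad s) {lam}
  (H : is_wdl (bar K) t s lam) x :
  val (homwdl X Ht Hs H x) = khcomp (snd lam) (snd (proj1_sig x)).
Proof. reflexivity. Qed.

Lemma bar_yb_left_left {A} {a1 a2 b c : mon (bar K) A} (H1 : is_monad a1) (H2 : is_monad a2)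
  (Hb : is_monad b) (Hc : is_monad c) {l12 l1b l1c l2b l2c l}
  (H12 : is_wdl (bar K) a2 a1 l12) (H1b : is_wdl (bar K) b a1 l1b)
  (H1c : is_wdl (bar K) c a1 l1c) (H2b : is_wdl (bar K) b a2 l2b)
  (H2c : is_wdl (bar K) c a2 l2c) (Hl : is_wdl (bar K) c b l)
  (Y1 : bar_yb a1 b c l1b l1c l) (Y2 : bar_yb a2 b c l2b l2c l)
  (Yb : bar_yb a1 a2 b l12 l1b l2b) (Yc : bar_yb a1 a2 c l12 l1c l2c) :
  bar_yb a1 a2 (wwp K b c l) l12 (leftlaw a1 b c l1b l1c l) (leftlaw a2 b c l2b l2c l).
Proof.
  exact (yb_of_homyb H12 (is_wdl_left H1 Hb Hc H1b H1c Hl Y1) (is_wdl_left H2 Hb Hc H2b H2c Hl Y2)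
    eq_refl eq_refl (wreath_homsplit A Hc Hb Hl (is_monad_wwp Hc Hb Hl))
    (val_homwdl A H2 H1 H12) (val_homleft H1 Hb Hc H1b H1c Hl Y1 A)
    (val_homleft H2 Hb Hc H2b H2c Hl Y2 A)
    (yb_left_left _ _ _ (homyb A H1 H2 Hb H12 H1b H2b Yb) (homyb A H1 H2 Hc H12 H1c H2c Yc))).
Qed.

Lemma bar_yb_left_right {A} {a b c d : mon (bar K) A} (Ha : is_monad a)
  (Hb : is_monad b) (Hc : is_monad c) (Hd : is_monad d) {lab lac lad lbd lcd l}
  (Hab : is_wdl (bar K) b a lab) (Hac : is_wdl (bar K) c a lac) (Had : is_wdl (bar K) d a lad)
  (Hbd : is_wdl (bar K) d b lbd) (Hcd : is_wdl (bar K) d c lcd) (Hl : is_wdl (bar K) c b l)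
  (Y1 : bar_yb a b c lab lac l) (Y2 : bar_yb b c d l lbd lcd)
  (Yb : bar_yb a b d lab lad lbd) (Yc : bar_yb a c d lac lad lcd) :
  bar_yb a (wwp K b c l) d (leftlaw a b c lab lac l) lad (rightlaw b c d lbd lcd l).
Proof.
  exact (yb_of_homyb (is_wdl_left Ha Hb Hc Hab Hac Hl Y1) Had
    (is_wdl_right Hb Hc Hd Hbd Hcd Hl Y2)
    eq_refl (wreath_homsplit A Hc Hb Hl (is_monad_wwp Hc Hb Hl)) eq_refl
    (val_homleft Ha Hb Hc Hab Hac Hl Y1 A) (val_homwdl A Hd Ha Had)
    (val_homright Hb Hc Hd Hbd Hcd Hl Y2 A)
    (yb_left_right _ _ _ (homyb A Ha Hb Hd Hab Had Hbd Yb) (homyb A Ha Hc Hd Hac Had Hcd Yc))).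
Qed.

Lemma bar_yb_right_right {A} {b c d1 d2 : mon (bar K) A} (Hb : is_monad b) (Hc : is_monad c)
  (H1 : is_monad d1) (H2 : is_monad d2) {lb1 lb2 lc1 lc2 l12 l}
  (Hb1 : is_wdl (bar K) d1 b lb1) (Hb2 : is_wdl (bar K) d2 b lb2)
  (Hc1 : is_wdl (bar K) d1 c lc1) (Hc2 : is_wdl (bar K) d2 c lc2)
  (H12 : is_wdl (bar K) d2 d1 l12) (Hl : is_wdl (bar K) c b l)
  (Y1 : bar_yb b c d1 l lb1 lc1) (Y2 : bar_yb b c d2 l lb2 lc2)
  (Yb : bar_yb b d1 d2 lb1 lb2 l12) (Yc : bar_yb c d1 d2 lc1 lc2 l12) :
  bar_yb (wwp K b c l) d1 d2 (rightlaw b c d1 lb1 lc1 l) (rightlaw b c d2 lb2 lc2 l) l12.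
Proof.
  exact (yb_of_homyb (is_wdl_right Hb Hc H1 Hb1 Hc1 Hl Y1) (is_wdl_right Hb Hc H2 Hb2 Hc2 Hl Y2)
    H12 (wreath_homsplit A Hc Hb Hl (is_monad_wwp Hc Hb Hl)) eq_refl eq_refl
    (val_homright Hb Hc H1 Hb1 Hc1 Hl Y1 A) (val_homright Hb Hc H2 Hb2 Hc2 Hl Y2 A)
    (val_homwdl A H2 H1 H12)
    (yb_right_right _ _ _ (homyb A Hb H1 H2 Hb1 Hb2 H12 Yb) (homyb A Hc H1 H2 Hc1 Hc2 H12 Yc))).
Qed.

(** * The merged 1-cell in the closure *)

Section Mor.
Context {A A' : kob K} {b c : mon (bar K) A} {b' c' : mon (bar K) A'}
  (Hb : is_monad b) (Hc : is_monad c) (Hb' : is_monad b') (Hc' : is_monad c')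
  {l : cell (bar K) A A} {l' : cell (bar K) A' A'}
  (Hl : is_wdl (bar K) c b l) (Hl' : is_wdl (bar K) c' b' l')
  {v : hom (bar K) A A'} (Hv : bok1 K v) {xb xc : cell (bar K) A A'}
  (Hxb : mnd1 (bar K) b b' v xb) (Hxc : mnd1 (bar K) c c' v xc)
  (E : wdl1 (bar K) c b l c' b' l' v xc xb).

Definition homwreathmor X :
  MndMor (wreath (homsplit Hc Hb Hl X)) (wreath (homsplit Hc' Hb' Hl' X)) (postcomp X v Hv) :=
  wmor (homwdlmor X Hc Hb Hc' Hb' Hl Hl' Hv Hxc Hxb E) (homsplit Hc Hb Hl X)
    (homsplit Hc' Hb' Hl' X).

Lemma val_homwreathmor X x : val (homwreathmor X x) =
  khcomp (snd (wreathmor b c b' c' l l' v xb xc)) (snd (proj1_sig x)).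
Proof.
  etransitivity; [exact (eq_sym (val_postcomp_inj Hc Hb Hl X Hv (homwreathmor X x)))|].
  etransitivity; [exact (f_equal val (inj_wmor_fun (xb := hommor X Hb Hb' Hv Hxb)
    (xc := hommor X Hc Hc' Hv Hxc) (homsplit Hc Hb Hl X) (homsplit Hc' Hb' Hl' X) x))|].
  transitivity (val (postcomp X v Hv <$> wbar (homwdl X Hc Hb Hl) x ∘
    hommor X Hb Hb' Hv Hxb (hommonad X c Hc x) ∘ hommonad X b' Hb' <$> hommor X Hc Hc' Hv Hxc x)).
  (* The 2-cell of [inj S'] is that of the target idempotent, which the remaining composite
     absorbs. *)
  - rewrite <- (wbar_Xi_wbar (homwdlmor X Hc Hb Hc' Hb' Hl Hl' Hv Hxc Hxb E) x).
    rewrite !val_cmp, (val_wbar _ Hc' Hb' Hl'). reflexivity.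
  - unfold wreathmor, retype. cbn [snd]. rewrite !snd_v, !snd_wl, !snd_wr.
    rewrite !val_cmp, val_fm, val_wbar.
    monad_facts Hb; monad_facts Hc; monad_facts Hb'; monad_facts Hc'.
    pose proof (typ_bok2 (proj1 (proj2 Hxb))). pose proof (typ_bok2 (proj1 (proj2 Hxc))).
    pose proof (bok2_lambar Hc Hb Hl).
    rewrite !(fun a b => whisker_r a b (proj2_sig x)), !hA by st. reflexivity.
Qed.

Lemma mnd1_wreath :
  mnd1 (bar K) (wwp K b c l) (wwp K b' c' l') v (wreathmor b c b' c' l l' v xb xc).
Proof.
  exact (mnd1_of_hommor (is_monad_wwp Hc Hb Hl) (is_monad_wwp Hc' Hb' Hl') Hv
    (wreath_homsplit A Hc Hb Hl _) (wreath_homsplit A Hc' Hb' Hl' _) (homwreathmor A)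
    (val_homwreathmor A) eq_refl eq_refl).
Qed.
End Mor.

Lemma val_hommor X {A A'} {m : mon (bar K) A} {m' : mon (bar K) A'} (Hm : is_monad m)
  (Hm' : is_monad m') {v : hom (bar K) A A'} (Hv : bok1 K v) {psi}
  (H : mnd1 (bar K) m m' v psi) x :
  val (hommor X Hm Hm' Hv H x) = khcomp (snd psi) (snd (proj1_sig x)).
Proof. reflexivity. Qed.

(** * The merged 1-cell against the other monads, under 2-cells and under composition *)

Section MorLeftRight.
Context {A A' : kob K} {b c : mon (bar K) A} {b' c' : mon (bar K) A'}
  (Hb : is_monad b) (Hc : is_monad c) (Hb' : is_monad b') (Hc' : is_monad c')
  {l : cell (bar K) A A} {l' : cell (bar K) A' A'}
  (Hl : is_wdl (bar K) c b l) (Hl' : is_wdl (bar K) c' b' l')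
  {v : hom (bar K) A A'} (Hv : bok1 K v) {xb xc : cell (bar K) A A'}
  (Hxb : mnd1 (bar K) b b' v xb) (Hxc : mnd1 (bar K) c c' v xc)
  (E : wdl1 (bar K) c b l c' b' l' v xc xb).

Lemma wdl1_left {a : mon (bar K) A} {a' : mon (bar K) A'} (Ha : is_monad a) (Ha' : is_monad a')
  {lab lac lab' lac' xa} (Hab : is_wdl (bar K) b a lab) (Hac : is_wdl (bar K) c a lac)
  (Hab' : is_wdl (bar K) b' a' lab') (Hac' : is_wdl (bar K) c' a' lac')
  (Y : bar_yb a b c lab lac l) (Y' : bar_yb a' b' c' lab' lac' l')
  (Hxa : mnd1 (bar K) a a' v xa)
  (Eab : wdl1 (bar K) b a lab b' a' lab' v xb xa) (Eac : wdl1 (bar K) c a lac c' a' lac' v xc xa) :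
  wdl1 (bar K) (wwp K b c l) a (leftlaw a b c lab lac l)
    (wwp K b' c' l') a' (leftlaw a' b' c' lab' lac' l') v
    (wreathmor b c b' c' l l' v xb xc) xa.
Proof.
  exact (wdl1_of_homwdlmor (is_wdl_left Ha Hb Hc Hab Hac Hl Y)
    (is_wdl_left Ha' Hb' Hc' Hab' Hac' Hl' Y')
    (mnd1_wreath Hb Hc Hb' Hc' Hl Hl' Hv Hxb Hxc E) Hxa
    (wreath_homsplit A Hc Hb Hl (is_monad_wwp Hc Hb Hl)) eq_refl
    (wreath_homsplit A Hc' Hb' Hl' (is_monad_wwp Hc' Hb' Hl')) eq_refl
    (val_homleft Ha Hb Hc Hab Hac Hl Y A) (val_homleft Ha' Hb' Hc' Hab' Hac' Hl' Y' A)
    (val_homwreathmor Hb Hc Hb' Hc' Hl Hl' Hv Hxb Hxc E A) (val_hommor A Ha Ha' Hv Hxa)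
    (lwdl_mor _ _ _ (homwdlmor A Hb Ha Hb' Ha' Hab Hab' Hv Hxb Hxa Eab)
      (homwdlmor A Hc Ha Hc' Ha' Hac Hac' Hv Hxc Hxa Eac) _ _)).
Qed.

Lemma wdl1_right {d : mon (bar K) A} {d' : mon (bar K) A'} (Hd : is_monad d) (Hd' : is_monad d')
  {lbd lcd lbd' lcd' xd} (Hbd : is_wdl (bar K) d b lbd) (Hcd : is_wdl (bar K) d c lcd)
  (Hbd' : is_wdl (bar K) d' b' lbd') (Hcd' : is_wdl (bar K) d' c' lcd')
  (Y : bar_yb b c d l lbd lcd) (Y' : bar_yb b' c' d' l' lbd' lcd')
  (Hxd : mnd1 (bar K) d d' v xd)
  (Ebd : wdl1 (bar K) d b lbd d' b' lbd' v xd xb) (Ecd : wdl1 (bar K) d c lcd d' c' lcd' v xd xc) :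
  wdl1 (bar K) d (wwp K b c l) (rightlaw b c d lbd lcd l)
    d' (wwp K b' c' l') (rightlaw b' c' d' lbd' lcd' l') v
    xd (wreathmor b c b' c' l l' v xb xc).
Proof.
  exact (wdl1_of_homwdlmor (is_wdl_right Hb Hc Hd Hbd Hcd Hl Y)
    (is_wdl_right Hb' Hc' Hd' Hbd' Hcd' Hl' Y')
    Hxd (mnd1_wreath Hb Hc Hb' Hc' Hl Hl' Hv Hxb Hxc E)
    eq_refl (wreath_homsplit A Hc Hb Hl (is_monad_wwp Hc Hb Hl))
    eq_refl (wreath_homsplit A Hc' Hb' Hl' (is_monad_wwp Hc' Hb' Hl'))
    (val_homright Hb Hc Hd Hbd Hcd Hl Y A) (val_homright Hb' Hc' Hd' Hbd' Hcd' Hl' Y' A)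
    (val_hommor A Hd Hd' Hv Hxd) (val_homwreathmor Hb Hc Hb' Hc' Hl Hl' Hv Hxb Hxc E A)
    (rwdl_mor _ _ _ (homwdlmor A Hd Hb Hd' Hb' Hbd Hbd' Hv Hxd Hxb Ebd)
      (homwdlmor A Hd Hc Hd' Hc' Hcd Hcd' Hv Hxd Hxc Ecd) _ _)).
Qed.

Lemma mnd2_wreath {v1 : hom (bar K) A A'} (Hv1 : bok1 K v1) {xb1 xc1 om : cell (bar K) A A'}
  (Hxb1 : mnd1 (bar K) b b' v1 xb1) (Hxc1 : mnd1 (bar K) c c' v1 xc1)
  (E1 : wdl1 (bar K) c b l c' b' l' v1 xc1 xb1)
  (Hob : mnd2 (bar K) b b' v v1 xb xb1 om) (Hoc : mnd2 (bar K) c c' v v1 xc xc1 om) :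
  mnd2 (bar K) (wwp K b c l) (wwp K b' c' l') v v1 (wreathmor b c b' c' l l' v xb xc)
    (wreathmor b c b' c' l l' v1 xb1 xc1) om.
Proof.
  destruct Hob as (Ho & Eb), Hoc as (_ & Ec). refine (conj Ho _).
  pose proof (typ_bok2 Ho) as Bo.
  (* [om] acts as a natural transformation between composition with [v] and with [v1]; its
     naturality lets it pass [prj] in [wmor_fun_om]. *)
  set (omx := fun x : homcat A A => cellat Bo x (y := postcomp A v Hv x)
    (z := postcomp A v1 Hv1 x) eq_refl eq_refl).
  assert (om_nat : forall x y (f : arr x y),
    omx y ∘ postcomp A v Hv <$> f = postcomp A v1 Hv1 <$> f ∘ omx x).
  { intros x y f. apply val_inj. exact (cell_nat Bo f). }
  monad_facts Hb; monad_facts Hc; monad_facts Hb'; monad_facts Hc'.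
  pose proof (typ_bok2 (proj1 (proj2 Hxb))). pose proof (typ_bok2 (proj1 (proj2 Hxc))).
  pose proof (typ_bok2 (proj1 (proj2 Hxb1))). pose proof (typ_bok2 (proj1 (proj2 Hxc1))).
  assert (omb : forall x, hommor A Hb Hb' Hv1 Hxb1 x ∘ hommonad A b' Hb' <$> omx x =
    omx (hommonad A b Hb x) ∘ hommor A Hb Hb' Hv Hxb x).
  { intros x. apply val_inj; cbn. whisker Eb x. exact Eb. }
  assert (omc : forall x, hommor A Hc Hc' Hv1 Hxc1 x ∘ hommonad A c' Hc' <$> omx x =
    omx (hommonad A c Hc x) ∘ hommor A Hc Hc' Hv Hxc x).
  { intros x. apply val_inj; cbn. whisker Ec x. exact Ec. }
  pose proof (wmor_fun_om omx om_nat omc omb (homsplit Hc Hb Hl A) (homsplit Hc' Hb' Hl' A)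
    (homid A)) as W.
  pose proof (val_homwreathmor Hb Hc Hb' Hc' Hl Hl' Hv Hxb Hxc E A (homid A)) as V.
  pose proof (val_homwreathmor Hb Hc Hb' Hc' Hl Hl' Hv1 Hxb1 Hxc1 E1 A (homid A)) as V1.
  rewrite snd_homid, hidr in V, V1.
  apply (f_equal val) in W. rewrite !val_cmp in W.
  apply bar_ext; [unfold wreathmor; bst|unfold wreathmor; bst|].
  rewrite !snd_v, !snd_wl, !snd_wr, <- V, <- V1.
  refine (eq_trans _ (eq_trans W _)); cbn; rewrite ?hidr; reflexivity.
Qed.

Lemma wreathmor_comp {A'' : kob K} {b'' c'' : mon (bar K) A''} (Hb'' : is_monad b'')
  (Hc'' : is_monad c'') (l'' : cell (bar K) A'' A'')
  {w : hom (bar K) A' A''} (Hw : bok1 K w) {zb zc : cell (bar K) A' A''}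
  (Hzb : mnd1 (bar K) b' b'' w zb) (Hzc : mnd1 (bar K) c' c'' w zc) :
  wreathmor b c b'' c'' l l'' (comp1 w v) (vcomp (wl w xb) (wr zb v)) (vcomp (wl w xc) (wr zc v))
  = vcomp (wl w (wreathmor b c b' c' l l' v xb xc)) (wr (wreathmor b' c' b'' c'' l' l'' w zb zc) v).
Proof.
  apply bar_ext; [unfold wreathmor; bst|unfold wreathmor; bst|].
  pose proof (wbar_Xi_comp (homwdlmor A Hc Hb Hc' Hb' Hl Hl' Hv Hxc Hxb E)
    (hommor A Hc' Hc'' Hw Hzc) (hommor A Hb' Hb'' Hw Hzb) (homid A)) as W.
  apply (f_equal val) in W. rewrite !val_cmp, !val_fm, !val_fmT, !val_wbar in W.
  monad_facts Hb; monad_facts Hc; monad_facts Hb'; monad_facts Hc'; monad_facts Hb'';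
    monad_facts Hc''.
  pose proof (typ_bok2 (proj1 (proj2 Hxb))). pose proof (typ_bok2 (proj1 (proj2 Hxc))).
  pose proof (typ_bok2 (proj1 (proj2 Hzb))). pose proof (typ_bok2 (proj1 (proj2 Hzc))).
  pose proof (bok2_lambar Hc Hb Hl). pose proof (bok2_lambar Hc' Hb' Hl').
  unfold wreathmor. rewrite !snd_v, !snd_wl, !snd_wr. cbn [retype snd].
  rewrite !snd_v, !snd_wl, !snd_wr, !snd_v, !snd_wl, !snd_wr, ?snd_comp1.
  repeat first [rewrite val_hommor in W | rewrite val_fm in W | rewrite snd_fobT in W
    | rewrite snd_fob in W | rewrite snd_homid in W | rewrite hidr in W].
  rewrite !(fun a b => whisker_r a b Hv), !(fun a b => whisker_r a b (proj1 Hc)),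
    !(fun a b => whisker_l a b Hw), !(fun a b => whisker_l a b (proj1 Hb'')), !hA by st.
  rewrite !vA by st. exact W.
Qed.
End MorLeftRight.

(** The identity 2-cell of the merged 1-cell is the idempotent itself, which is all that remains of
    the formula on identities. *)
Lemma wreathmor_id {A} {b c : mon (bar K) A} (Hb : is_monad b) (Hc : is_monad c) {l}
  (Hl : is_wdl (bar K) c b l) :
  wreathmor b c b c l l (id1 (C := bar K) A) (id2 (mt b)) (id2 (mt c)) = id2 (wwp_hom K b c l).
Proof.
  apply bar_ext; [unfold wreathmor; bst|unfold wreathmor; bst|].
  pose proof (bok2_lambar Hc Hb Hl) as B.
  unfold wreathmor. cbn [retype snd]. rewrite !snd_v, !snd_wl, !snd_wr, !snd_id2.
  change (snd (id1 (C := bar K) A)) with (kid2 (K := K) (kid1 A)). rewrite hidl.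
  change (khcomp (snd (mt b)) (snd (mt c))) with (snd (comp1 (C := bar K) (mt b) (mt c))).
  rewrite (proj2 (proj2 (proj1 B))). exact (bok2_r B).
Qed.
End TwoCategoryLaws.

(** * The 2-functor *)

Section Ck.
Context {K : PreTwoCat} (HK : is_two_category K) {n k : nat} (Hk : 1 <= k <= n).
Local Notation p := (k - 1).

Lemma old_le i : i <= n - 1 -> old k i <= n.
Proof. unfold old. destruct (Nat.ltb_spec i p); lia. Qed.
(** The order is kept through the merged index as well: there [old] takes the value [S (k - 1)],
    that is [k]. *)
Lemma old_lt i j : i < j -> old k i < old k j.
Proof. unfold old. destruct (Nat.ltb_spec i p), (Nat.ltb_spec j p); lia. Qed.
Lemma old_left i : i < p -> old k i < p.
Proof. unfold old. destruct (Nat.ltb_spec i p); lia. Qed.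
Lemma old_right i : p < i -> k < old k i.
Proof. unfold old. destruct (Nat.ltb_spec i p); lia. Qed.

Lemma Ck_mon_p (X : wdln0 (bar K)) :
  ws (Ck0 k X) p = wwp K (ws X p) (ws X k) (wlam X p k).
Proof. cbn [Ck0 ws wlam]. unfold Ck_mon. now rewrite Nat.ltb_irrefl, Nat.eqb_refl. Qed.
Lemma Ck_mon_old (X : wdln0 (bar K)) i : i <> p -> ws (Ck0 k X) i = ws X (old k i).
Proof.
  intros H. cbn [Ck0 ws wlam]. unfold Ck_mon, old. rewrite (proj2 (Nat.eqb_neq _ _) H).
  now destruct (i <? p).
Qed.

Lemma Ck_lam_left (X : wdln0 (bar K)) i : i < p -> wlam (Ck0 k X) i p =
  leftlaw (ws X (old k i)) (ws X p) (ws X k) (wlam X (old k i) p) (wlam X (old k i) k)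
    (wlam X p k).
Proof.
  intros H. cbn [Ck0 ws wlam]. unfold Ck_lam, old.
  rewrite (proj2 (Nat.eqb_neq _ _)), Nat.eqb_refl, (proj2 (Nat.ltb_lt _ _) H) by lia.
  reflexivity.
Qed.
Lemma Ck_lam_right (X : wdln0 (bar K)) j : p < j -> wlam (Ck0 k X) p j =
  rightlaw (ws X p) (ws X k) (ws X (old k j)) (wlam X p (old k j)) (wlam X k (old k j))
    (wlam X p k).
Proof.
  intros H. cbn [Ck0 ws wlam]. unfold Ck_lam, old.
  rewrite Nat.eqb_refl, (proj2 (Nat.ltb_ge _ _)) by lia. reflexivity.
Qed.
Lemma Ck_lam_old (X : wdln0 (bar K)) i j : i <> p -> j <> p ->
  wlam (Ck0 k X) i j = wlam X (old k i) (old k j).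
Proof.
  intros Hi Hj. cbn [Ck0 ws wlam]. unfold Ck_lam. now rewrite !(proj2 (Nat.eqb_neq _ _)).
Qed.

Lemma Ck_xi_p {X Y : wdln0 (bar K)} (F : wdln1 X Y) : wxi (Ck1 k F) p =
  wreathmor (ws X p) (ws X k) (ws Y p) (ws Y k) (wlam X p k) (wlam Y p k) (wv F)
    (wxi F p) (wxi F k).
Proof. cbn [Ck1 wxi]. now rewrite Nat.ltb_irrefl, Nat.eqb_refl. Qed.
Lemma Ck_xi_old {X Y : wdln0 (bar K)} (F : wdln1 X Y) i : i <> p ->
  wxi (Ck1 k F) i = wxi F (old k i).
Proof.
  intros H. cbn [Ck1 wxi]. unfold old. rewrite (proj2 (Nat.eqb_neq _ _) H). now destruct (i <? p).
Qed.

(** * The image of a 0-cell *)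

Section ZeroCell.
Context {X : wdln0 (bar K)} (HX : is_wdln0 n X).

Lemma wdln0_monad i : i <= n -> is_monad (ws X i).
Proof. apply HX. Qed.
Lemma wdln0_wdl i j : i < j -> j <= n -> is_wdl (bar K) (ws X j) (ws X i) (wlam X i j).
Proof. intros. apply HX; auto. Qed.
Lemma wdln0_yb i j m : i < j -> j < m -> m <= n ->
  bar_yb (ws X i) (ws X j) (ws X m) (wlam X i j) (wlam X i m) (wlam X j m).
Proof. intros. apply HX; auto. Qed.

Lemma Ck0_wdln0 : is_wdln0 (n - 1) (Ck0 k X).
Proof.
  refine (conj _ (conj _ _)).
  - intros i Hi. destruct (Nat.eq_dec i p) as [->|Ni].
    + rewrite Ck_mon_p. apply (is_monad_wwp HK);
        [apply wdln0_monad|apply wdln0_monad|apply wdln0_wdl]; lia.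
    + rewrite (Ck_mon_old _ _ Ni). apply wdln0_monad, old_le, Hi.
  - intros i j [Hij Hj].
    pose proof (old_lt _ _ Hij). pose proof (old_le _ Hj).
    destruct (Nat.eq_dec i p) as [->|Ni]; [|destruct (Nat.eq_dec j p) as [->|Nj]].
    + pose proof (old_right _ Hij).
      rewrite Ck_mon_p, Ck_lam_right, Ck_mon_old by lia.
      apply (is_wdl_right HK);
        solve [apply wdln0_monad; lia | apply wdln0_wdl; lia | apply wdln0_yb; lia].
    + pose proof (old_left _ Hij).
      rewrite Ck_mon_p, Ck_lam_left, Ck_mon_old by lia.
      apply (is_wdl_left HK);
        solve [apply wdln0_monad; lia | apply wdln0_wdl; lia | apply wdln0_yb; lia].
    + rewrite Ck_lam_old, !Ck_mon_old by trivial. apply wdln0_wdl; trivial.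
  - intros i j m [[Hij Hjm] Hm].
    pose proof (old_lt _ _ Hij). pose proof (old_lt _ _ Hjm). pose proof (old_le _ Hm).
    change (bar_yb (ws (Ck0 k X) i) (ws (Ck0 k X) j) (ws (Ck0 k X) m)
      (wlam (Ck0 k X) i j) (wlam (Ck0 k X) i m) (wlam (Ck0 k X) j m)).
    (* The merged monad can be the first, second or third of the three, each with its own relation;
       otherwise the relation is a given one. *)
    destruct (Nat.eq_dec i p) as [->|Ni];
      [|destruct (Nat.eq_dec j p) as [->|Nj]; [|destruct (Nat.eq_dec m p) as [->|Nm]]].
    + pose proof (old_right _ Hij). pose proof (old_right m ltac:(lia)).
      rewrite Ck_mon_p, !Ck_lam_right, Ck_lam_old, !Ck_mon_old by lia.
      apply (bar_yb_right_right HK);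
        solve [apply wdln0_monad; lia | apply wdln0_wdl; lia | apply wdln0_yb; lia].
    + pose proof (old_left _ Hij). pose proof (old_right m ltac:(lia)).
      rewrite Ck_mon_p, Ck_lam_left, Ck_lam_right, Ck_lam_old, !Ck_mon_old by lia.
      apply (bar_yb_left_right HK);
        solve [apply wdln0_monad; lia | apply wdln0_wdl; lia | apply wdln0_yb; lia].
    + pose proof (old_left j ltac:(lia)). pose proof (old_left i ltac:(lia)).
      rewrite Ck_mon_p, !Ck_lam_left, Ck_lam_old, !Ck_mon_old by lia.
      apply (bar_yb_left_left HK);
        solve [apply wdln0_monad; lia | apply wdln0_wdl; lia | apply wdln0_yb; lia].
    + rewrite !Ck_lam_old, !Ck_mon_old by trivial. apply wdln0_yb; trivial.
Qed.
End ZeroCell.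

(** * The image of a 1-cell *)

Section OneCell.
Context {X Y : wdln0 (bar K)} (HX : is_wdln0 n X) (HY : is_wdln0 n Y) {F : wdln1 X Y}
  (HF : is_wdln1 n F).

Lemma wdln1_mnd1 i : i <= n -> mnd1 (bar K) (ws X i) (ws Y i) (wv F) (wxi F i).
Proof. apply HF. Qed.
Lemma wdln1_wdl1 i j : i < j -> j <= n -> wdl1 (bar K) (ws X j) (ws X i) (wlam X i j)
  (ws Y j) (ws Y i) (wlam Y i j) (wv F) (wxi F j) (wxi F i).
Proof. intros. apply HF; auto. Qed.
Lemma wdln1_ok1 : bok1 K (wv F).
Proof. exact (proj1 (wdln1_mnd1 0 (Nat.le_0_l n))). Qed.

Ltac cells := first
  [ apply (wdln0_monad HX); lia | apply (wdln0_monad HY); lia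
  | apply (wdln0_wdl HX); lia | apply (wdln0_wdl HY); lia
  | apply (wdln0_yb HX); lia | apply (wdln0_yb HY); lia
  | apply wdln1_ok1 | apply wdln1_mnd1; lia | apply wdln1_wdl1; lia ].

Lemma Ck1_mnd1 i : i <= n - 1 ->
  mnd1 (bar K) (ws (Ck0 k X) i) (ws (Ck0 k Y) i) (wv F) (wxi (Ck1 k F) i).
Proof.
  intros Hi. destruct (Nat.eq_dec i p) as [->|Ni].
  - rewrite !Ck_mon_p, Ck_xi_p.
    apply (mnd1_wreath HK); cells.
  - rewrite (Ck_xi_old F i Ni), !(Ck_mon_old _ i Ni). apply wdln1_mnd1, old_le, Hi.
Qed.

Lemma Ck1_wdln1 : is_wdln1 (n - 1) (Ck1 k F).
Proof.
  split; [exact Ck1_mnd1|].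
  intros i j [Hij Hj]. pose proof (old_lt _ _ Hij). pose proof (old_le _ Hj).
  change (wv (Ck1 k F)) with (wv F).
  destruct (Nat.eq_dec i p) as [->|Ni]; [|destruct (Nat.eq_dec j p) as [->|Nj]].
  - pose proof (old_right _ Hij).
    rewrite !Ck_mon_p, !Ck_lam_right, Ck_xi_p, Ck_xi_old, !Ck_mon_old by lia.
    apply (wdl1_right HK); cells.
  - pose proof (old_left _ Hij).
    rewrite !Ck_mon_p, !Ck_lam_left, Ck_xi_p, Ck_xi_old, !Ck_mon_old by lia.
    apply (wdl1_left HK); cells.
  - rewrite !Ck_lam_old, !Ck_xi_old, !Ck_mon_old by trivial. apply wdln1_wdl1; trivial.
Qed.
End OneCell.
End Ck.

Theorem theorem2p6 (K : PreTwoCat) (HK : is_two_category K) (n k : nat)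
  (Hk : 1 <= k <= n) :
  (* 0-cells are sent to 0-cells *)
  (forall X : wdln0 (bar K), is_wdln0 n X -> is_wdln0 (n - 1) (Ck0 k X)) /\
  (* 1-cells are sent to 1-cells *)
  (forall (X Y : wdln0 (bar K)) (F : wdln1 X Y),
     is_wdln0 n X -> is_wdln0 n Y -> is_wdln1 n F ->
     is_wdln1 (n - 1) (Ck1 k F)) /\
  (* 2-cells are sent to 2-cells *)
  (forall (X Y : wdln0 (bar K)) (F G : wdln1 X Y) (omega : cell (bar K) (wob X) (wob Y)),
     is_wdln0 n X -> is_wdln0 n Y -> is_wdln1 n F -> is_wdln1 n G ->
     is_wdln2 n F G omega ->
     is_wdln2 (n - 1) (Ck1 k F) (Ck1 k G) omega) /\
  (* identity 1-cells are preserved *)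
  (forall X : wdln0 (bar K), is_wdln0 n X ->
     wv (Ck1 k (wid X)) = wv (wid (Ck0 k X)) /\
     (forall i, i <= n - 1 -> wxi (Ck1 k (wid X)) i = wxi (wid (Ck0 k X)) i)) /\
  (* composition of 1-cells is preserved *)
  (forall (X Y Z : wdln0 (bar K)) (F : wdln1 X Y) (G : wdln1 Y Z),
     is_wdln0 n X -> is_wdln0 n Y -> is_wdln0 n Z ->
     is_wdln1 n F -> is_wdln1 n G ->
     wv (Ck1 k (wcomp F G)) = wv (wcomp (Ck1 k F) (Ck1 k G)) /\
     (forall i, i <= n - 1 ->
        wxi (Ck1 k (wcomp F G)) i = wxi (wcomp (Ck1 k F) (Ck1 k G)) i)).
Proof.
  refine (conj _ (conj _ (conj _ (conj _ _)))).
  - intros X HX. exact (Ck0_wdln0 HK Hk HX).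
  - intros X Y F HX HY HF. exact (Ck1_wdln1 HK Hk HX HY HF).
  - intros X Y F G omega HX HY HF HG Ho i Hi.
    change (wv (Ck1 k F)) with (wv F). change (wv (Ck1 k G)) with (wv G).
    (* At every index other than the merged one, the condition is the given condition at the old
       index. *)
    destruct (Nat.eq_dec i (k - 1)) as [->|Ni].
    + rewrite !Ck_mon_p, !Ck_xi_p.
      eapply (mnd2_wreath HK); first
       [ apply (wdln0_monad HX); lia | apply (wdln0_monad HY); lia
       | apply (wdln0_wdl HX); lia | apply (wdln0_wdl HY); lia
       | apply (wdln1_ok1 HF) | apply (wdln1_ok1 HG)
       | apply (wdln1_mnd1 HF); lia | apply (wdln1_mnd1 HG); lia
       | apply (wdln1_wdl1 HF); lia | apply (wdln1_wdl1 HG); lia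
       | apply Ho; lia ].
    + rewrite !(Ck_xi_old _ i Ni), !(Ck_mon_old _ i Ni). apply Ho, (old_le Hk), Hi.
  - intros X HX. split; [reflexivity|]. intros i Hi.
    destruct (Nat.eq_dec i (k - 1)) as [->|Ni].
    + rewrite Ck_xi_p. cbn [wid wxi wv]. rewrite Ck_mon_p.
      apply (wreathmor_id HK);
        [apply (wdln0_monad HX)|apply (wdln0_monad HX)|apply (wdln0_wdl HX)]; lia.
    + rewrite (Ck_xi_old _ i Ni). cbn [wid wxi]. now rewrite (Ck_mon_old _ i Ni).
  - intros X Y Z F G HX HY HZ HF HG. split; [reflexivity|]. intros i Hi.
    destruct (Nat.eq_dec i (k - 1)) as [->|Ni].
    + rewrite Ck_xi_p. cbn [wcomp wxi wv]. rewrite !Ck_xi_p.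
      eapply (wreathmor_comp HK); first
       [ apply (wdln0_monad HX); lia | apply (wdln0_monad HY); lia | apply (wdln0_monad HZ); lia
       | apply (wdln0_wdl HX); lia | apply (wdln0_wdl HY); lia
       | apply (wdln1_ok1 HF) | apply (wdln1_ok1 HG)
       | apply (wdln1_mnd1 HF); lia | apply (wdln1_mnd1 HG); lia
       | apply (wdln1_wdl1 HF); lia ].
    + rewrite (Ck_xi_old _ i Ni). cbn [wcomp wxi]. now rewrite !(Ck_xi_old _ i Ni).
Qed.
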